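(* For every positive integer $k$ there exists an effectively computable constant $C_0(k)>0$, depending only on $k$, such that the following holds: if $N, M, a, b$ are positive integers satisfying $\sigma(N)=aM$, $\sigma(M)=bN$ and $\omega(\sigma(N))\leq k$, then $a<C_0(k)$ and $b<C_0(k)$.
   Context: $\sigma(n)$ denotes the sum of the positive divisors of a positive integer $n$, and $\omega(n)$ denotes the number of distinct prime factors of $n$. ''Effectively computable constant depending only on $k$'' means that the constant can be given by a computable function of $k$. *)

(* Defs.v *)
From mathcomp Require Import all_boot.

Set Implicit Arguments.
Unset Strict Implicit.
Unset Printing Implicit Defensive.

Definition sigma (n : nat) : nat := \sum_(d <- divisors n) d.

Definition omega (n : nat) : nat := size (primes n).

(* Kleene's total (general) recursive functions. Each clause takes its defining
   equations as pointwise hypotheses on f, so that the class is closed under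
   extensional equality. In rec_mu the regularity condition
   "for all x there is y with g (y, x) = 0" follows from the first equation. *)
Inductive recursive : forall n : nat, (n.-tuple nat -> nat) -> Prop :=
| rec_zero n (f : n.-tuple nat -> nat) :
    (forall x, f x = 0) -> recursive f
| rec_succ (f : 1.-tuple nat -> nat) :
    (forall x, f x = (thead x).+1) -> recursive f
| rec_proj n (i : 'I_n) (f : n.-tuple nat -> nat) :
    (forall x, f x = tnth x i) -> recursive f
| rec_comp n m (h : m.-tuple nat -> nat) (g : 'I_m -> n.-tuple nat -> nat)
    (f : n.-tuple nat -> nat) :
    recursive h -> (forall i, recursive (g i)) ->
    (forall x, f x = h [tuple g i x | i < m]) -> recursive f
| rec_prim n (g : n.-tuple nat -> nat) (h : n.+2.-tuple nat -> nat)
    (f : n.+1.-tuple nat -> nat) :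
    recursive g -> recursive h ->
    (forall x : n.-tuple nat, f [tuple of 0 :: x] = g x) ->
    (forall (y : nat) (x : n.-tuple nat),
        f [tuple of y.+1 :: x]
        = h [tuple of y :: f [tuple of y :: x] :: x]) ->
    recursive f
| rec_mu n (g : n.+1.-tuple nat -> nat) (f : n.-tuple nat -> nat) :
    recursive g ->
    (forall x : n.-tuple nat, g [tuple of f x :: x] = 0) ->
    (forall (x : n.-tuple nat) (y : nat),
        y < f x -> g [tuple of y :: x] <> 0) ->
    recursive f.

Definition computable (f : nat -> nat) : Prop :=
  recursive (fun x : 1.-tuple nat => f (thead x)).

(* Main.v *)
(** Write S for the set of primes dividing sigma N, so |S| <= k.  As M divides
    sigma N, it has at most k prime factors, hence sigma M <= (k+1) M, and
    a b = (sigma N / N) (sigma M / M) reduces everything to bounding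
    sigma N / N, i.e. the sum of 1/q over the primes q dividing N.

    For such q let r be a prime factor of v_q(N)+1; then
    Q = 1 + q + ... + q^(r-1) divides sigma N and has all its prime factors in S.
    Consider the q in [2^i, 2^(i+1)).  Those with r below a power of i are
    determined by r and the exponents of S in Q, which leaves polynomially many
    (in i).  If too many had larger r, one could pick k+1 of them with
    multiplicatively independent q-1; as Q is nearly q^r/(q-1), eliminating S
    gives a nonzero linear form in the 2k+2 logarithms of the numbers q and q-1
    which is smaller than 2^(-min r), against Baker's theorem.  This needs
    log max r to be small against min r: if p in S divides all the Q's, each r is
    at most p (Fermat), hence at most each Q, and such a family splits into two
    halves with r_max much smaller than exp(r_min) on each.

    Baker's theorem is proved for logarithms of integers by his original method,
    with real Hermite interpolation in place of contour integrals. *)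
Require Import Defs.
From mathcomp Require Import all_boot.
From HB Require Import structures.
From mathcomp Require Import all_order all_algebra cyclic.
From mathcomp Require Import ring lra zify.
From mathcomp Require Import boolp classical_sets functions reals topology.
From mathcomp Require Import normedtype sequences derive realfun exp.
Set Implicit Arguments.
Unset Strict Implicit.
Unset Printing Implicit Defensive.
Import Order.TTheory GRing.Theory Num.Theory numFieldNormedType.Exports.

(** * Hermite interpolation of exponentials *)

Local Open Scope ring_scope.

(** Baker's method is elementary here because the numbers under the logarithms are positive
    integers: the auxiliary function, also after insertion of the factors [gamprod], takes integer
    values at natural numbers. An estimate below 1 is therefore already an exact zero, and no
    heights or norms of algebraic numbers enter. All frequencies are real, and the interpolation
    remainder is controlled by a first-order linear differential equation.

    What decides is the shape of the lower bound. It must be 2^(-B) with B polynomial in i and in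
    the bit length of the largest r, because it is played against 2^(-r) for the smallest r.
    Polynomial losses in i are harmless: a block with polynomially many primes contributes a
    polynomial in i divided by 2^i to the sum of 1/q. Dyadic blocks also ensure that no q of a block
    divides another q' - 1, which keeps the q independent of the q - 1. All constants are explicit
    in k, which gives computability at the end. *)

Lemma nonneg_of_derive_nonneg (R : realType) (f df : R -> R) :
  (forall w : R, is_derive w (1 : R) f (df w)) -> f 0 = 0 ->
  (forall w, 0 <= w -> 0 <= df w) -> forall w, 0 <= w -> 0 <= f w.
Proof.
move=> fE f0 df0 w w0.
have D x : derivable f x 1 by have [] := fE x.
have h : {in `[0, w] &, {homo f : x y / x <= y >-> x <= y}}.
  apply: ger0_derive1_le_cc => [x _|x|].
  - exact: D.
  - rewrite in_itv/= derive1E => /andP[x0 _].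
    by have [_ ->] := fE x; apply: df0; exact: ltW.
  - apply: continuous_subspaceT => x.
    exact/differentiable_continuous/derivable1_diffP/D.
by rewrite -f0; apply: h => //; rewrite in_itv/= lexx w0.
Qed.

(** The factor 1/t! lets differentiation lower t without a coefficient, so the recursions for the
    interpolation coefficients contain no factorials. *)
Definition expterm (R : realType) (l : R) (t : nat) (w : R) : R :=
  w ^+ t / t`!%:R * expR (l * w).

Lemma is_derive_expterm (R : realType) (l : R) t (w : R) :
  is_derive w (1 : R) (expterm l t)
    (l * expterm l t w + (if t is s.+1 then expterm l s w else 0)).
Proof.
rewrite /expterm.
have -> : (fun w0 : R => w0 ^+ t / t`!%:R * expR (l * w0)) =
  (t`!%:R^-1 \*: ((id ^+ t : R -> R) * (expR \o (l \*: id)))).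
  apply/funext => x; rewrite !fctE /= /GRing.scale/=; ring.
apply: is_derive_eq; rewrite !fctE /= /GRing.scale/=.
case: t => [|t]; first by rewrite !fact0 !invr1 expr0; ring.
rewrite factS natrM invfM /=.
have t1 : t.+1%:R != 0 :> R by rewrite pnatr_eq0.
have t2 : t`!%:R != 0 :> R by rewrite pnatr_eq0 -lt0n fact_gt0.
by rewrite exprS; field; rewrite t2 nat1r.
Qed.

Lemma expterm_ge0 (R : realType) (l : R) t (w : R) : 0 <= w -> 0 <= expterm l t w.
Proof.
by move=> w0; rewrite mulr_ge0 ?expR_ge0// divr_ge0 ?exprn_ge0.
Qed.

(** The majorant G = x^(N+1) expterm x (N+1) satisfies G' = x G + x (x^N expterm x N), the equation
    of f with a, c and g replaced by their bounds. Hence (G - s f) e^(-aw) is nondecreasing for both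
    signs s, and it vanishes at 0. *)
Lemma ode_bound_nonneg (R : realType) (f g : R -> R) (a c x : R) (N : nat) :
  a <= x -> `|c| <= x ->
  (forall w : R, is_derive w (1 : R) f (a * f w + c * g w)) -> f 0 = 0 ->
  (forall w, 0 <= w -> `|g w| <= x ^+ N * expterm x N w) ->
  forall w, 0 <= w -> `|f w| <= x ^+ N.+1 * expterm x N.+1 w.
Proof.
move=> ax cx fE f0 gB.
have x0 : 0 <= x by rewrite (le_trans _ cx).
have key (s : R) : `|s| = 1 -> forall w, 0 <= w ->
    s * f w <= x ^+ N.+1 * expterm x N.+1 w.
  move=> s1.
  pose F := ((x ^+ N.+1 \*: expterm x N.+1 - s \*: f)
             * (expR \o (- a \*: id)) : R -> R).
  pose dF w := ((x - a) * (x ^+ N.+1 * expterm x N.+1 w)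
      + (x * (x ^+ N * expterm x N w) - s * (c * g w))) * expR (- a * w).
  have FE (w : R) : is_derive w (1 : R) F (dF w).
    have := fE w; have := is_derive_expterm x N.+1 w => d1 d2.
    apply: is_derive_eq; rewrite /dF !fctE /= /GRing.scale /= exprS; ring.
  have F0 : F 0 = 0.
    by rewrite /F !fctE /= /GRing.scale /= f0 /expterm expr0n /=; ring.
  have dF0 w : 0 <= w -> 0 <= dF w.
    move=> w0; rewrite mulr_ge0 ?expR_ge0// addr_ge0//.
      by rewrite mulr_ge0 ?subr_ge0// mulr_ge0 ?exprn_ge0// expterm_ge0.
    rewrite subr_ge0 (le_trans (ler_norm _))// !normrM s1 mul1r.
    by rewrite ler_pM// gB.
  move=> w w0; have := nonneg_of_derive_nonneg FE F0 dF0 w0.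
  rewrite /F !fctE /= /GRing.scale /= pmulr_lge0 ?expR_gt0//.
  by rewrite subr_ge0.
move=> w w0; rewrite ler_norml lerNl.
have := key 1 (normr1 _) w w0; rewrite mul1r => ->; rewrite andbT.
by have := key (-1) _ w w0; rewrite mulN1r; apply; rewrite normrN normr1.
Qed.

(** For w < 0 the reflected function f(-w) satisfies an equation of the same kind with -a and -(x -
    a); this is why the preceding lemma is stated for a <= x and |c| <= x. *)
Lemma ode_bound (R : realType) (f g : R -> R) (a x : R) (N : nat) :
  0 <= a -> a <= x ->
  (forall w : R, is_derive w (1 : R) f (a * f w + (x - a) * g w)) -> f 0 = 0 ->
  (forall w, `|g w| <= x ^+ N * expterm x N `|w|) ->
  forall w, `|f w| <= x ^+ N.+1 * expterm x N.+1 `|w|.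
Proof.
move=> a0 ax fE f0 gB w.
have cx : `|x - a| <= x by rewrite ger0_norm ?subr_ge0// gerBl.
have [w0|w0] := leP 0 w.
  rewrite (ger0_norm w0).
  apply: (ode_bound_nonneg ax cx fE f0) => // v v0.
  by have := gB v; rewrite (ger0_norm v0).
have fE' (v : R) : is_derive v (1 : R) (f \o -%R)
    (- a * f (- v) + - (x - a) * g (- v)).
  have d1 : is_derive v (1 : R) (-%R : R -> R) (- 1) by exact: is_deriveNid.
  have d2 := fE (- v).
  apply: is_derive_eq.
  rewrite /GRing.scale /=; ring.
have := @ode_bound_nonneg _ (f \o -%R) (g \o -%R) (- a) (- (x - a)) x N _ _ fE' _ _ `|w|.
rewrite /= [- `|w|](_ : _ = w); last by rewrite ltr0_norm// opprK.
apply => //.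
- by rewrite (le_trans _ (le_trans a0 ax))// oppr_le0.
- by rewrite normrN.
- by rewrite oppr0.
by move=> v v0; rewrite (le_trans (gB _))// normrN ger0_norm.
Qed.

Definition expsum (R : realType) (h T : nat) (p : nat -> nat -> R) (w : R) : R :=
  \sum_(l < h) \sum_(t < T) p l t * expterm l%:R t w.

Lemma is_derive_expsum (R : realType) h T (p : nat -> nat -> R) (w : R) :
  (forall l, p l T = 0) ->
  is_derive w (1 : R) (expsum h T p)
    (expsum h T (fun l t => l%:R * p l t + p l t.+1) w).
Proof.
move=> pT.
pose dp l t := p l t * (l%:R * expterm l%:R t w
   + (if t is s.+1 then expterm l%:R s w else 0)).
have -> : expsum h T p = \sum_(l < h) \sum_(t < T) p l t \*: expterm l%:R t.
  by apply/funext => v; rewrite /expsum fct_sumE; apply: eq_bigr => l _;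
     rewrite fct_sumE; apply: eq_bigr.
have D : is_derive w (1 : R) (\sum_(l < h) \sum_(t < T) p l t \*: expterm l%:R t)
    (\sum_(l < h) \sum_(t < T) dp l t).
  apply: is_derive_sum => l; apply: is_derive_sum => t.
  have d1 := is_derive_expterm (l%:R : R) t w.
  exact: is_derive_eq.
apply: (is_derive_eq D); apply: eq_bigr => l _; rewrite /dp.
clear D dp; case: T pT => [|T] pT; first by rewrite !big_ord0.
under eq_bigr do rewrite mulrDr.
rewrite big_split/=; under [RHS]eq_bigr do rewrite mulrDl.
rewrite [RHS]big_split/=; congr (_ + _).
  by apply: eq_bigr => t _; ring.
by rewrite big_ord_recl mulr0 add0r [RHS]big_ord_recr/= pT mul0r addr0.
Qed.

(* The remainder E(w) = e^(xw) - sum_(l,t) p l t * w^t/t! * e^(lw) vanishes at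
   w = 0 to the order given by the number of interpolation nodes used so far.
   Adding the node a replaces E by the solution F of F' - a F = (x - a) E,
   F(0) = 0, whose coefficients are [hermite_next].  The nodes are added in the
   order 0 (T times), 1 (T times), and so on: s copies of a are in place here. *)
Section HermiteStep.
Variables (R : realType) (h T x a s : nat) (p : nat -> nat -> R).
Hypotheses (ax : (a < x)%N) (ah : (a < h)%N) (sT : (s < T)%N).
Hypothesis supp : forall l t, (T <= t)%N || (a < l)%N || (a <= l)%N && (s <= t)%N
  -> p l t = 0.

Let c : R := x%:R - a%:R.
(** For l < a, comparing coefficients in F' - a F = (x - a) E gives p' l (t+1) = (a - l) p' l t + c
    p l t; solved downwards from the value 0 at t = T, this is [low]. In the resonant row l = a the
    equation leaves the entry at t = 0 free, and F(0) = 0 fixes it. *)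
Let low l t : R := - c * \sum_(u < T | (t <= u)%N) p l u / (a%:R - l%:R) ^+ (u - t).+1.
Definition hermite_next l t : R :=
  if (l < a)%N then low l t else
  if l == a then
    (if t is u.+1 then c * p a u else 1 - \sum_(i < h | (i < a)%N) low i 0)
  else 0.
Let p' := hermite_next.

Lemma hermite_next_supp l t :
  (T <= t)%N || (a < l)%N || (a <= l)%N && (s < t)%N -> p' l t = 0.
Proof.
rewrite /p' /hermite_next => H; case: (ltnP l a) => [la|al].
  have Tt : (T <= t)%N by lia.
  rewrite /low big_pred0 ?mulr0// => u.
  by apply/negbTE; rewrite -ltnNge (leq_trans (ltn_ord u)).
case: eqVneq => // la; rewrite {}la {al} in H *.
case: t H => [|t] H; first by lia.
by rewrite supp ?mulr0//; apply/orP; lia.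
Qed.

Lemma hermite_next_rec l t : (t < T)%N ->
  l%:R * p' l t + p' l t.+1 = a%:R * p' l t + c * p l t.
Proof.
move=> tT; rewrite /p' /hermite_next; case: (ltnP l a) => [la|al]; last first.
  case: eqVneq => [->//|la]; rewrite supp ?mulr0 ?addr0// ltn_neqAle.
  by rewrite eq_sym la al orbT.
have al0 : a%:R - l%:R != 0 :> R by rewrite subr_eq0 eqr_nat neq_ltn la orbT.
suff E : low l t.+1 = (a%:R - l%:R) * low l t + c * p l t by rewrite E; ring.
rewrite /low [in RHS](bigD1 (Ordinal tT))//= subnn expr1.
rewrite (eq_bigl (fun u : 'I_T => (t <= u)%N && (u != Ordinal tT))) => [|u]; last first.
  by rewrite ltn_neqAle andbC eq_sym.
rewrite !mulrDr -addrA addrCA -[LHS]addr0; congr (_ + _); last first.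
  by field.
rewrite mulrCA; congr (_ * _); rewrite mulr_sumr; apply: eq_bigr => u /andP[tu ut].
have {}tu : (t < u)%N by rewrite ltn_neqAle tu andbT eq_sym.
by rewrite subnSK// exprS; field; rewrite al0 expf_neq0.
Qed.

Lemma hermite_next_head : \sum_(l < h) p' l 0 = 1.
Proof.
rewrite (bigD1 (Ordinal ah))//= {1}/p' /hermite_next ltnn eqxx.
rewrite [X in _ + X](bigID (fun l : 'I_h => (l < a)%N))/= [X in _ + (_ + X)]big1 => [|l]; last first.
  case/andP => la /negbTE al; rewrite -val_eqE/= in la.
  by rewrite /p' /hermite_next al (negbTE la).
rewrite addr0 [X in _ + X](_ : _ = \sum_(i < h | (i < a)%N) low i 0) ?subrK//.
apply: eq_big => [l|l /andP[_ al]]; last by rewrite /p' /hermite_next al.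
by rewrite -val_eqE/= neq_ltn; case: (ltnP l a); rewrite ?andbF.
Qed.

Let b l := \sum_(t < T) `|p l t|.

Let c0 : 0 <= c. Proof. by rewrite subr_ge0 ler_nat ltnW. Qed.
Let cx : c <= x%:R. Proof. by rewrite gerBl. Qed.

Lemma hermite_low_bound l t : (l < a)%N -> `|low l t| <= x%:R * b l.
Proof.
move=> la; rewrite normrM normrN (ger0_norm c0) ler_pM//.
apply: (le_trans (ler_norm_sum _ _ _)).
rewrite /b [leRHS](bigID (fun u : 'I_T => (t <= u)%N))/= -[leLHS]addr0 lerD ?sumr_ge0//.
apply: ler_sum => u _; rewrite normrM ler_piMr// normfV invf_le1.
  rewrite normrX exprn_ege1// -natrB; last exact: ltnW.
  by rewrite normr_nat ler1n subn_gt0.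
by rewrite normr_gt0 expf_neq0// subr_eq0 eqr_nat neq_ltn la orbT.
Qed.

(** The summand 1 on both sides absorbs the inhomogeneous 1 in the entry (a, 0), so that the
    estimate is purely multiplicative and iterates to a power. The denominators are powers of the
    positive integers a - l and cost nothing. *)
Lemma hermite_next_bound :
  \sum_(l < h) \sum_(t < T) `|p' l t| + 1 <= (x * T.+2)%:R * (\sum_(l < h) b l + 1).
Proof.
have T0 : (0 < T)%N by exact: leq_ltn_trans sT.
have bge0 l : 0 <= b l by rewrite sumr_ge0.
have x1 : 1 <= x%:R :> R by rewrite ler1n (leq_ltn_trans _ ax).
set B := \sum_(l < h | (l < a)%N) b l.
have lowB : \sum_(l < h | (l < a)%N) \sum_(t < T) `|p' l t| <= x%:R * T%:R * B.
  rewrite mulr_sumr; apply: ler_sum => l la.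
  rewrite -mulrA mulrCA mulr_natl -[X in _ *+ X]card_ord -sumr_const.
  by apply: ler_sum => t _; rewrite /p' /hermite_next la hermite_low_bound.
have midB : \sum_(t < T) `|p' a t| <= (1 + x%:R * B) + x%:R * b a.
  rewrite -(big_mkord xpredT (fun t => `|p' a t|)) big_ltn// big_add1/= lerD//.
    rewrite /p' /hermite_next ltnn eqxx (le_trans (ler_normB _ _))// normr1 lerD2l.
    rewrite mulr_sumr (le_trans (ler_norm_sum _ _ _))//; apply: ler_sum => l la.
    exact: hermite_low_bound.
  rewrite /b -(big_mkord xpredT (fun t => `|p a t|)) mulr_sumr.
  rewrite [leRHS](big_cat_nat _ (leq_pred T))//= -[leLHS]addr0 lerD//; last first.
    by rewrite sumr_ge0// => i _; rewrite mulr_ge0.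
  apply: ler_sum => t _; rewrite /p' /hermite_next ltnn eqxx normrM (ger0_norm c0).
  by rewrite ler_wpM2r.
have E (f : nat -> R) : (forall l, (a < l)%N -> f l = 0) ->
    \sum_(l < h) f l = \sum_(l < h | (l < a)%N) f l + f a.
  move=> f0; rewrite (bigID (fun l : 'I_h => (l < a)%N))/=; congr (_ + _).
  rewrite (bigD1 (Ordinal ah))/= ?ltnn// big1 ?addr0// => l /andP[la].
  by rewrite -val_eqE/= => la'; rewrite f0// ltn_neqAle eq_sym la' leqNgt la.
have pE l : (a < l)%N -> \sum_(t < T) `|p' l t| = 0.
  by move=> al; rewrite big1// => t _; rewrite hermite_next_supp ?normr0// al orbT.
have bE l : (a < l)%N -> b l = 0.
  by move=> al; rewrite /b big1// => t _; rewrite supp ?normr0// al orbT.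
rewrite (E _ pE) (E _ bE).
have B0 : 0 <= B by rewrite sumr_ge0.
have T1 : 1 <= T%:R :> R by rewrite ler1n.
rewrite natrM -addn2 natrD -/B.
have := bge0 a; move: lowB midB B0 T1 x1.
move: (\sum_(l < h | _) _) (\sum_(t < T) _) (b a) B (x%:R) (T%:R).
move=> u v r B z y uB vB B0 y1 z1 r0.
have zB : 0 <= z * B by nra.
have zr : 0 <= z * r by nra.
have yzr : 0 <= z * y * r by nra.
have zy : 1 <= z * y by nra.
nra.
Qed.

End HermiteStep.

(** The number [a * T + s] counts the nodes in use: those below a with multiplicity T, and a with
    multiplicity s. *)
Definition hermite_upto (R : realType) (h T x a s : nat) (p : nat -> nat -> R) :=
  [/\ forall l t, (T <= t)%N || (a < l)%N || (a <= l)%N && (s <= t)%N -> p l t = 0,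
      \sum_(l < h) \sum_(t < T) `|p l t| + 1 <= (x * T.+2)%:R ^+ (a * T + s) &
      forall w, `|expR (x%:R * w) - expsum h T p w|
                <= x%:R ^+ (a * T + s) * expterm x%:R (a * T + s) `|w| ].

Lemma hermite_uptoS (R : realType) (h T x a s : nat) (p : nat -> nat -> R) :
  (h <= x)%N -> (a < h)%N -> (s < T)%N ->
  hermite_upto h T x a s p -> hermite_upto h T x a s.+1 (hermite_next h T x a p).
Proof.
move=> hx ah sT [supp pB pE]; have ax := leq_trans ah hx.
set p' := hermite_next _ _ _ _ _.
have supp' := hermite_next_supp ax ah sT supp; rewrite -/p' in supp'.
rewrite /hermite_upto addnS; split => //.
  rewrite exprS; apply: (le_trans (hermite_next_bound ax ah sT supp)).
  by rewrite ler_wpM2l.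
apply: (@ode_bound _ (fun w => expR (x%:R * w) - expsum h T p' w)
  (fun w => expR (x%:R * w) - expsum h T p w) a%:R _ _ (ler0n _ _) _ _ _ pE).
- by rewrite ler_nat ltnW.
- move=> w.
  have p'T l : p' l T = 0 by apply: supp'; rewrite leqnn.
  have d1 := is_derive_expsum h w p'T.
  have d2 : is_derive w (1 : R) (expR \o (x%:R \*: id) - expsum h T p')
     (x%:R * expR (x%:R * w) - expsum h T (fun l t => l%:R * p' l t + p' l t.+1) w).
    by apply: is_derive_eq; rewrite /GRing.scale/= mulr1 mulrC.
  apply: (is_derive_eq d2).
  suff -> : expsum h T (fun l t => l%:R * p' l t + p' l t.+1) w =
      a%:R * expsum h T p' w + (x%:R - a%:R) * expsum h T p w by ring.
  rewrite /expsum !mulr_sumr -big_split/=; apply: eq_bigr => l _.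
  rewrite !mulr_sumr -big_split/=; apply: eq_bigr => t _.
  by have := hermite_next_rec h x supp l (ltn_ord t); rewrite -/p' => ->; ring.
- rewrite mulr0 expR0 -(hermite_next_head T x p ah) -/p'; apply/eqP.
  rewrite subr_eq0; apply/eqP/eq_bigr => l _.
  case: T sT {supp pB pE} @p' supp' => // T' _ p' _.
  rewrite big_ord_recl big1 => [|t _].
    by rewrite /expterm expr0 fact0 mulr0 expR0 divr1 !mulr1 addr0.
  by rewrite /expterm exprS !mul0r mulr0.
Qed.

(** This is Hermite interpolation of z -> e^(zw) at the integers z < h, each of multiplicity T,
    evaluated at z = x; the data w^t e^(lw) are the derivatives in z. The coefficients do not depend
    on w, so one formula serves all frequencies of an exponential sum. *)
Lemma hermite_exp (R : realType) (h T x : nat) :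
  (0 < h)%N -> (h <= x)%N -> exists p : nat -> nat -> R,
    \sum_(l < h) \sum_(t < T) `|p l t| <= (x * T.+2)%:R ^+ (h * T) /\
    forall w, `|expR (x%:R * w) - expsum h T p w|
              <= x%:R ^+ (h * T) * expterm x%:R (h * T) `|w|.
Proof.
move=> h0 hx.
have H a : (a < h)%N -> exists p : nat -> nat -> R, hermite_upto h T x a T p.
  elim: a => [ah|a IHa ah].
    suff H s : (s <= T)%N -> exists p : nat -> nat -> R, hermite_upto h T x 0 s p.
      exact: H.
    elim: s => [_|s IHs sT].
      exists (fun _ _ => 0); split => [//||w].
        rewrite big1 ?add0r ?expr0// => l _; rewrite big1// => t _; exact: normr0.
      rewrite /expsum big1 => [|l _]; last by rewrite big1// => t _; rewrite mul0r.
      rewrite subr0 /expterm !expr0 fact0 divr1 !mul1r ger0_norm ?expR_ge0//.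
      by rewrite ler_expR ler_wpM2l// ler_norm.
    have [p pP] := IHs (ltnW sT).
    by exists (hermite_next h T x 0 p); apply: hermite_uptoS.
  suff H s : (s <= T)%N -> exists p : nat -> nat -> R, hermite_upto h T x a.+1 s p.
    exact: H.
  elim: s => [_|s IHs sT].
    have [p [supp pB pE]] := IHa (ltnW ah).
    exists p; rewrite /hermite_upto addn0 mulSn addnC; split => // l t H.
    by apply: supp; lia.
  have [p pP] := IHs (ltnW sT).
  by exists (hermite_next h T x a.+1 p); apply: hermite_uptoS.
have [|p [_ pB pE]] := H h.-1; first by rewrite prednK.
rewrite addnC -mulSn prednK// in pB pE.
exists p; split => //; apply: le_trans pB; by rewrite lerDl.
Qed.

(** * Extrapolation of exponential sums *)

Lemma expR_sub1_bound (R : realType) (y : R) :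
  `|y| <= 2^-1 -> `|expR y - 1| <= 2 * `|y|.
Proof.
move=> y2; have [y0|y0] := leP 0 y.
  have e1 : 1 <= expR y by rewrite -expR0 ler_expR.
  rewrite (ger0_norm y0) in y2; rewrite (ger0_norm y0) ger0_norm ?subr_ge0//.
  have := expR_ge1Dx (- y); have := expRxMexpNx_1 y; have := expR_gt0 y.
  move: e1; move: (expR y) (expR (- y)) => a b a1 a0 ab yb.
  have : a * (1 - y) <= 1 by rewrite -[leRHS]ab ler_wpM2l// ltW.
  nra.
have := expR_ge1Dx y; have : expR y < 1 by rewrite expR_lt1.
rewrite (ltr0_norm y0) => e1 ye; rewrite ltr0_norm ?subr_lt0//; lra.
Qed.

Lemma expR1_le4 (R : realType) : expR 1 <= 4 :> R.
Proof.
have := @expR_sub1_bound R 2^-1.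
rewrite ger0_norm ?invr_ge0// => /(_ (lexx _)).
rewrite mulfV ?pnatr_eq0// => /ler_normlP[_ h].
have -> : (1 : R) = 2%:R * 2^-1 by rewrite mulfV ?pnatr_eq0.
rewrite expRM_natl; have : 0 <= expR (2^-1) :> R by exact: expR_ge0.
move: h; move: (expR _) => a; rewrite expr2; nra.
Qed.

Lemma expR_nat_le (R : realType) (n : nat) : expR n%:R <= 4 ^+ n :> R.
Proof.
by rewrite -[n%:R]mulr1 expRM_natl lerXn2r// ?nnegrE ?expR_ge0// expR1_le4.
Qed.

(** Interpolation replaces e^(x u_i) by a combination of the w_i^t e^(l u_i) with coefficients
    independent of i, which the hypothesis annihilates. There remain the Hermite remainder at w_i
    and the cost of exchanging u_i and w_i in the exponentials. The mixed data, w in the powers and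
    u in the exponents, are those for which the auxiliary function has exact relations. *)
Lemma extrapolation_bound (R : realType) (I : finType) (c w u : I -> R)
    (h T x : nat) (W d : R) :
  (0 < h)%N -> (h <= x)%N -> 1 <= W ->
  (forall i, `|w i| <= W) -> (forall i, `|u i - w i| <= d) -> x%:R * d <= 2^-1 ->
  (forall l t, (l < h)%N -> (t < T)%N ->
     \sum_i c i * (w i ^+ t * expR (l%:R * u i)) = 0) ->
  `|\sum_i c i * expR (x%:R * u i)| <= (\sum_i `|c i|) *
     (x%:R ^+ (h * T) * expterm x%:R (h * T) W
      + (2 * (x%:R * d) * expR (x%:R * W)) * (1 + (x * T.+2)%:R ^+ (h * T) * W ^+ T)).
Proof.
move=> h0 hx W1 wW ud xd van.
have [p [pB pE]] := hermite_exp R T h0 hx.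
pose S' i := \sum_(l < h) \sum_(t < T) p l t * (w i ^+ t / t`!%:R * expR (l%:R * u i)).
have cS' : \sum_i c i * S' i = 0.
  rewrite /S'; under eq_bigr do rewrite mulr_sumr.
  rewrite exchange_big/= big1// => l _.
  under eq_bigr do rewrite mulr_sumr.
  rewrite exchange_big/= big1// => t _.
  rewrite (eq_bigr (fun i => p l t / t`!%:R * (c i * (w i ^+ t * expR (l%:R * u i))))).
    by rewrite -mulr_sumr van ?mulr0.
  by move=> i _; ring.
have -> : \sum_i c i * expR (x%:R * u i) = \sum_i c i * (expR (x%:R * u i) - S' i).
  under [RHS]eq_bigr do rewrite mulrBr.
  by rewrite sumrB cS' subr0.
have W0 : 0 <= W by lra.
have d0 (i : I) : 0 <= d by exact: le_trans (normr_ge0 _) (ud i).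
have euw l i : (l <= x)%N ->
    `|expR (l%:R * u i) - expR (l%:R * w i)| <= 2 * (x%:R * d) * expR (x%:R * W).
  move=> lx; have -> : l%:R * u i = l%:R * w i + l%:R * (u i - w i) by ring.
  have yB : `|l%:R * (u i - w i)| <= x%:R * d.
    by rewrite normrM normr_nat ler_pM// ler_nat.
  rewrite expRD -[X in _ - X]mulr1 -mulrBr normrM mulrC ler_pM//.
    by apply: (le_trans (expR_sub1_bound (le_trans yB xd))); rewrite ler_pM2l.
  rewrite ger0_norm ?expR_ge0// ler_expR (le_trans (ler_norm _))// normrM normr_nat.
  by rewrite ler_pM// ler_nat.
set E := 2 * (x%:R * d) * _ in euw *.
apply: (le_trans (ler_norm_sum _ _ _)); rewrite mulr_suml; apply: ler_sum => i _.
have E0 : 0 <= E by rewrite mulr_ge0 ?expR_ge0// mulr_ge0// mulr_ge0// (d0 i).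
rewrite normrM ler_wpM2l//.
have -> : expR (x%:R * u i) - S' i = (expR (x%:R * w i) - expsum h T p (w i))
    + (expR (x%:R * u i) - expR (x%:R * w i)) + (expsum h T p (w i) - S' i) by ring.
clearbody E; rewrite [E * _]mulrDr mulr1 [leRHS]addrA.
apply: (le_trans (ler_normD _ _)); apply: lerD.
  apply: (le_trans (ler_normD _ _)); apply: lerD; last exact: euw.
  apply: (le_trans (pE _)); rewrite ler_wpM2l// ?exprn_ge0//.
  rewrite /expterm ler_pM ?expR_ge0 ?divr_ge0 ?exprn_ge0//.
    by rewrite ler_wpM2r ?invr_ge0// lerXn2r// ?nnegrE.
  by rewrite ler_expR ler_wpM2l.
rewrite /S' /expsum -sumrB.
apply: (@le_trans _ _ ((\sum_(l < h) \sum_(t < T) `|p l t|) * (E * W ^+ T))); last first.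
  by rewrite mulrCA ler_wpM2l// ler_wpM2r// exprn_ge0.
apply: (le_trans (ler_norm_sum _ _ _)); rewrite mulr_suml; apply: ler_sum => l _.
rewrite -sumrB; apply: (le_trans (ler_norm_sum _ _ _)).
rewrite mulr_suml; apply: ler_sum => t _.
rewrite -mulrBr normrM ler_wpM2l// /expterm -mulrBr normrM mulrC ler_pM//.
  by rewrite distrC euw// ltnW// (leq_trans (ltn_ord l)).
rewrite normrM normfV normr_nat ler_pdivrMr ?ltr0n ?fact_gt0//.
apply: (@le_trans _ _ (W ^+ T)).
  rewrite normrX (@le_trans _ _ (W ^+ t))//; first by rewrite lerXn2r// ?nnegrE.
  by rewrite ler_weXn2l// ltnW.
by rewrite ler_peMr ?exprn_ge0// ler1n fact_gt0.
Qed.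

(** With N = h T, the Hermite part is at most (xW)^N/N! e^(xW) times the sum of the |c_i|. As N^N/N!
    <= 4^N, the factor 64^(-N) beats 4^N and two factors 2^N and leaves 4^(-N). The condition on Z
    brings the other error below 1/4 as well. *)
Lemma extrapolation_lt1 (R : realType) (I : finType) (c w u : I -> R)
    (h T x W v Z : nat) :
  (0 < h)%N -> (h <= x)%N -> (0 < T)%N -> (0 < W)%N ->
  (forall i, `|w i| <= W%:R) -> (forall i, `|u i - w i| <= (2 ^+ Z)^-1) ->
  (64 * (x * W) <= h * T)%N ->
  (x <= 2 ^ v)%N -> (T.+2 <= 2 ^ v)%N -> (W <= 2 ^ v)%N ->
  (4 * (v.+1 * (h * T).+1) <= Z)%N ->
  \sum_i `|c i| <= 2 ^+ (h * T) ->
  (forall l t, (l < h)%N -> (t < T)%N ->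
     \sum_i c i * (w i ^+ t * expR (l%:R * u i)) = 0) ->
  `|\sum_i c i * expR (x%:R * u i)| < 1.
Proof.
move=> h0 hx T0 W0 wW uw xWN xv Tv Wv ZN cN van.
set N := (h * T)%N in xWN ZN cN *.
have N0 : (0 < N)%N by rewrite muln_gt0 h0.
have TN : (T <= N)%N by rewrite leq_pmull.
have x0 : (0 < x)%N by exact: leq_trans hx.
have p2 n : 0 < 2 ^+ n :> R by rewrite exprn_gt0.
have exW : expR (x%:R * W%:R) <= 2 ^+ N :> R.
  rewrite -natrM (le_trans (expR_nat_le _ _))// (_ : 4 = 2 ^+ 2); last by rewrite -natrX.
  by rewrite -exprM ler_eXn2l ?ltr1n//; lia.
have xR : x%:R <= 2 ^+ v :> R by rewrite -natrX ler_nat.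
have xd : x%:R * (2 ^+ Z)^-1 <= 2^-1 :> R.
  rewrite ler_pdivrMr// (le_trans xR)// ler_pdivlMl// -exprS ler_eXn2l ?ltr1n//.
  nia.
have W1 : 1 <= W%:R :> R by rewrite ler1n.
have [] := (extrapolation_bound h0 hx W1 wW uw xd van, @lt_le_trans).
move=> /le_lt_trans B _; apply: B; rewrite -/N.
apply: (@le_lt_trans _ _ (4^-1 + 4^-1)); last by lra.
rewrite mulrDr lerD//.
  have N0R : 0 < N%:R :> R by rewrite ltr0n.
  have NN : N%:R ^+ N / N`!%:R <= 4 ^+ N :> R.
    have := @expR_ge1Dxn R N%:R N.-1 (ler0n _ _); rewrite prednK// => h1.
    apply: le_trans (expR_nat_le _ N); apply: le_trans h1.
    by rewrite lerDr.
  have xN : x%:R * W%:R <= N%:R / 64 :> R.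
    by rewrite ler_pdivlMr// -!natrM ler_nat; lia.
  have -> : x%:R ^+ N * expterm x%:R N W%:R =
     (x%:R * W%:R) ^+ N / N`!%:R * expR (x%:R * W%:R) :> R.
    by rewrite /expterm exprMn; ring.
  have h1 : (x%:R * W%:R) ^+ N / N`!%:R <= (4 / 64) ^+ N :> R.
    apply: (@le_trans _ _ ((N%:R / 64) ^+ N / N`!%:R)).
      rewrite ler_wpM2r ?invr_ge0//; apply: lerXn2r => //; rewrite nnegrE; [exact: mulr_ge0|exact: divr_ge0].
    rewrite !exprMn -mulrA [X in _ * X]mulrC mulrA ler_wpM2r// exprn_ge0//.
    by rewrite invr_ge0.
  apply: (@le_trans _ _ (2 ^+ N * ((4 / 64) ^+ N * 2 ^+ N))).
    rewrite ler_pM// ?sumr_ge0//; first by rewrite mulr_ge0 ?expR_ge0// divr_ge0 ?exprn_ge0 ?mulr_ge0.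
    by rewrite ler_pM ?expR_ge0// divr_ge0 ?exprn_ge0 ?mulr_ge0.
  rewrite -!exprMn (_ : 2 * (4 / 64 * 2) = 4^-1); last by field.
  have q1 : (4^-1 : R) <= 1 by rewrite invf_le1// ler1n.
  by rewrite -[leRHS]expr1 ler_wiXn2l// invr_ge0.
have TR : (x * T.+2)%:R <= 2 ^+ (2 * v) :> R.
  by rewrite -natrX ler_nat mul2n -addnn expnD leq_mul.
have WR : W%:R <= 2 ^+ v :> R by rewrite -natrX ler_nat.
have K : 1 + (x * T.+2)%:R ^+ N * W%:R ^+ T <= 2 ^+ (1 + 2 * v * N + v * T) :> R.
  have K0 : (x * T.+2)%:R ^+ N * W%:R ^+ T <= 2 ^+ (2 * v * N + v * T) :> R.
    rewrite exprD (exprM _ _ N) (exprM _ _ T).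
    by apply: ler_pM; rewrite ?exprn_ge0//; apply: lerXn2r; rewrite ?nnegrE ?ler0n ?exprn_ge0.
  rewrite -addnA add1n exprS mulr_natl mulr2n lerD// exprn_ege1// ler1n//.
apply: (@le_trans _ _ (2 ^+ N * ((2 * (2 ^+ v * (2 ^+ Z)^-1) * 2 ^+ N) *
   2 ^+ (1 + 2 * v * N + v * T)))).
  have q0 : 0 <= (2 ^+ Z)^-1 :> R by rewrite invr_ge0 ltW.
  rewrite ler_pM ?sumr_ge0//.
    by rewrite !mulr_ge0 ?expR_ge0// addr_ge0// mulr_ge0 ?exprn_ge0.
  rewrite ler_pM//.
  - by rewrite !mulr_ge0 ?expR_ge0.
  - by rewrite addr_ge0// mulr_ge0 ?exprn_ge0.
  rewrite ler_pM// ?expR_ge0 ?mulr_ge0// ler_wpM2l// ler_wpM2r//.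
have -> : 2 ^+ N * (2 * (2 ^+ v / 2 ^+ Z) * 2 ^+ N * 2 ^+ (1 + 2 * v * N + v * T)) =
   2 ^+ (N + (1 + v + N + (1 + 2 * v * N + v * T))) / 2 ^+ Z :> R.
  by rewrite !exprD expr1; ring.
rewrite ler_pdivrMr// ler_pdivlMl// (_ : 4 = 2 ^+ 2); last by rewrite -natrX.
rewrite -exprD ler_eXn2l ?ltr1n//.
apply: leq_trans ZN; nia.
Qed.

(** * Siegel's lemma *)

(** Pigeonhole on the vectors with entries in 0..P, whose images have coordinates in [-K, K]: two of
    them share an image, and their difference is the solution. *)
Lemma siegel (I J : finType) (a : J -> I -> int) (A P : nat) :
  (forall j i, `|a j i| <= A%:Z) ->
  ((2 * (#|I| * A * P)).+1 ^ #|J| < P.+1 ^ #|I|)%N ->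
  exists p : I -> int, [/\ exists i, p i != 0, forall i, `|p i| <= P%:Z &
    forall j, \sum_i a j i * p i = 0].
Proof.
move=> aA card_lt; set K := (#|I| * A * P)%N in card_lt.
pose s (x : {ffun I -> 'I_P.+1}) j : int := \sum_i a j i * (x i : nat)%:Z.
have sK x j : `|s x j| <= K%:Z.
  apply: (le_trans (ler_norm_sum _ _ _)).
  apply: (@le_trans _ _ (\sum_(i : I) (A * P)%N%:Z)); last first.
    by rewrite sumr_const /K -mulnA -mulr_natl PoszM natz.
  apply: ler_sum => i _; rewrite normrM PoszM ler_pM//.
  by have := ltn_ord (x i); lia.
pose F x := [ffun j => inord (absz (s x j + K%:Z)) : 'I_(2 * K).+1].
have /injectivePn [x [y xy Fxy]] : ~~ injectiveb F.
  apply/negP => /injectiveP /leq_card.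
  by rewrite !card_ffun !card_ord leqNgt card_lt.
exists (fun i => (x i : nat)%:Z - (y i : nat)%:Z); split.
- apply/existsP; rewrite -negb_forall; apply: contra xy => /forallP E.
  by apply/eqP/ffunP => i; apply/val_inj; move/eqP: (E i) => /=; lia.
- by move=> i; have := ltn_ord (x i); have := ltn_ord (y i); lia.
move=> j; suff : s x j = s y j.
  move=> E; under eq_bigr do rewrite mulrBr.
  by rewrite sumrB; apply/eqP; rewrite subr_eq0; apply/eqP.
have /ffunP/(_ j) := Fxy; rewrite !ffunE => /(congr1 val)/=.
have := sK x j; have := sK y j; move: (s x j) (s y j) => u v.
by move=> uK vK; rewrite !inordK; lia.
Qed.

(** * Baker's theorem for logarithms of integers *)

(** The relations are tested against the polynomial that vanishes at all v i except v i0; its degree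
    |I| - 1 is within the range of the known power sums. *)
Lemma power_sums_eq0 (F : fieldType) (I : finType) (v p : I -> F) :
  injective v -> (forall l, (l < #|I|)%N -> \sum_i p i * v i ^+ l = 0) ->
  forall i, p i = 0.
Proof.
move=> v_inj van i0.
pose P := \prod_(i | i != i0) ('X - (v i)%:P).
have szP : size P = #|I|.
  rewrite /P -big_filter size_prod_XsubC size_filter -sum1_count.
  by rewrite sum1_card cardC1 prednK//; apply/card_gt0P; exists i0.
have : \sum_i p i * P.[v i] = 0.
  under eq_bigr do rewrite horner_coef szP mulr_sumr.
  rewrite exchange_big/= big1// => l _.
  rewrite (eq_bigr (fun i => P`_l * (p i * v i ^+ l))) => [|i _]; last by ring.
  by rewrite -mulr_sumr van ?mulr0.
rewrite (bigD1 i0)//= big1 ?addr0 => [|i ii0].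
  move/eqP; rewrite mulf_eq0 => /orP[/eqP//|].
  rewrite /P horner_prod prodf_seq_eq0 => /hasP[i _ /andP[ii0]].
  by rewrite hornerXsubC subr_eq0 => /eqP/v_inj e; rewrite e eqxx in ii0.
by rewrite /P (bigD1 i)//= hornerM hornerXsubC subrr mul0r mulr0.
Qed.

Lemma leq_expn2r (m n e : nat) : (m <= n)%N -> (m ^ e <= n ^ e)%N.
Proof. by move=> mn; case: e => // e; rewrite leq_exp2r. Qed.

Section BakerFunction.
Variables (d L a0 : nat) (a : 'I_d -> nat) (b0 : int) (b : 'I_d -> int).

(* An index k : lam stands for the function z |-> (monval k)^z.  If the linear
   form b0 ln a0 + sum_j b_j ln a_j were 0, its frequency ln (monval k) would be
   sum_j gam j k * (ln a_j / b0); so [vanishing p D h] says that, up to an error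
   of the size of the linear form, all derivatives of order < D of
   z |-> sum_k p k * (monval k)^z vanish at the integers < h.  A monomial in the
   gam j is encoded as the sequence s of its factors. *)
Definition lam := ('I_L * {ffun 'I_d -> 'I_L})%type.

Definition monval (k : lam) : nat := (a0 ^ k.1 * \prod_j a j ^ k.2 j)%N.

Definition gam (j : 'I_d) (k : lam) : int := b0 * (k.2 j)%:Z - b j * (k.1)%:Z.

Definition gamprod (s : seq 'I_d) (k : lam) : int := \prod_(j <- s) gam j k.

Definition vanishing (p : lam -> int) (D h : nat) :=
  forall s l, (size s < D)%N -> (l < h)%N ->
    \sum_k p k * gamprod s k * (monval k)%:Z ^+ l = 0.

Variables (beta ell y : nat).
Hypotheses (LE : L = (2 ^ ell)%N)
  (b0B : `|b0| <= (2 ^ beta)%:Z) (bB : forall j, `|b j| <= (2 ^ beta)%:Z)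
  (a0B : (0 < a0 <= 2 ^ y)%N) (aB : forall j, (0 < a j <= 2 ^ y)%N).

Lemma gam_bound j k : `|gam j k| <= (2 ^ (beta + 1 + ell))%N%:Z.
Proof.
have -> : (2 ^ (beta + 1 + ell))%N%:Z = (2 ^ beta)%:Z * L%:Z + (2 ^ beta)%:Z * L%:Z.
  by rewrite -PoszM -PoszD addnn -mul2n LE mulnA -expnS -expnD addn1.
have k1 := ltn_ord k.1; have k2 := ltn_ord (k.2 j).
rewrite (le_trans (ler_normB _ _))// !normrM lerD// ler_pM//; lia.
Qed.

Lemma gamprod_bound s k : `|gamprod s k| <= (2 ^ ((beta + 1 + ell) * size s))%N%:Z.
Proof.
rewrite /gamprod; elim: s => [|j s IHs]; first by rewrite big_nil muln0.
by rewrite big_cons mulnS expnD PoszM normrM ler_pM// gam_bound.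
Qed.

Lemma monval_bound k : (0 < monval k <= 2 ^ (y * (d.+1 * L)))%N.
Proof.
have pb c (m : 'I_L) : (0 < c <= 2 ^ y)%N -> (0 < c ^ m <= 2 ^ (y * L))%N.
  case/andP => c0 cB; rewrite expn_gt0 c0/= expnM.
  by rewrite (leq_trans (leq_expn2r _ cB))// leq_pexp2l ?expn_gt0// ltnW.
have /andP[m0 mB] := pb _ k.1 a0B.
have : (0 < \prod_j a j ^ k.2 j <= \prod_(j < d) 2 ^ (y * L))%N.
  apply: (big_ind2 (fun u v => 0 < u <= v)%N) => // [u v u' v' /andP[h1 h2] /andP[h3 h4]|j _].
    by rewrite muln_gt0 h1 h3 leq_mul.
  exact: pb.
rewrite prod_nat_const card_ord -expnM => /andP[m1 m1B].
have -> : (y * (d.+1 * L) = y * L + y * L * d)%N by lia.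
by rewrite /monval muln_gt0 m0 m1/= expnD leq_mul.
Qed.

Lemma gamprod_cons s j k : gamprod (j :: s) k = gam j k * gamprod s k.
Proof. by rewrite /gamprod big_cons. Qed.

(** One equation for each exponent vector in [0, T)^d covers all sequences of fewer than T factors.
    The unknowns are twice as many as the J equations, and P is chosen so that Siegel's condition
    becomes (P^2 + 1)^J < (P + 1)^(2J). *)
Lemma exists_vanishing (h T P : nat) : (0 < h)%N -> (0 < T)%N ->
  (2 * (T ^ d * h) = L ^ d.+1)%N ->
  (P = 2 * (L ^ d.+1 * 2 ^ ((beta + 1 + ell) * (d * T) + y * (d.+1 * L) * h)))%N ->
  exists p : lam -> int, [/\ exists k, p k != 0, forall k, `|p k| <= P%:Z &
    vanishing p T h].
Proof.
move=> h0 T0 TL PE.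
pose J := ({ffun 'I_d -> 'I_T} * 'I_h)%type.
pose A := (2 ^ ((beta + 1 + ell) * (d * T) + y * (d.+1 * L) * h))%N.
pose c (j : J) (k : lam) : int := (\prod_i gam i k ^+ j.1 i) * (monval k)%:Z ^+ j.2.
have cardI : #|{: lam}| = (L ^ d.+1)%N by rewrite card_prod card_ffun !card_ord expnS.
have cardJ : #|{: J}| = (T ^ d * h)%N by rewrite card_prod card_ffun !card_ord.
have cA j k : `|c j k| <= A%:Z.
  rewrite /c /A expnD PoszM normrM ler_pM//; last first.
    have /andP[_ mB] := monval_bound k.
    rewrite normrX ger0_norm// -!natz -natrX ler_nat expnM.
    apply: (leq_trans (leq_expn2r _ mB)).
    by rewrite leq_pexp2l ?expn_gt0// ltnW.
  rewrite normr_prod.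
  have -> : (2 ^ ((beta + 1 + ell) * (d * T)))%N%:Z =
      \prod_(i < d) (2 ^ ((beta + 1 + ell) * T))%N%:Z.
    have -> : ((beta + 1 + ell) * (d * T) = (beta + 1 + ell) * T * d)%N by lia.
    by rewrite prodr_const card_ord -!natz -natrX -expnM.
  apply: ler_prod => i _; rewrite normr_ge0/= normrX expnM -!natz natrX.
  apply: (@le_trans _ _ ((2 ^ (beta + 1 + ell))%:R ^+ j.1 i)).
    by rewrite lerXn2r ?nnegrE//; have := gam_bound i k; rewrite natz.
  by rewrite ler_weXn2l// ?ler1n ?expn_gt0// ltnW.
have [|p [p0 pP pv]] := siegel (P := P) cA.
  have P2 : (2 * (L ^ d.+1 * A * P) = P * P)%N by rewrite [in RHS]PE -/A; lia.
  rewrite cardI cardJ P2 -TL (expnM P.+1) ltn_exp2r ?muln_gt0 ?expn_gt0 ?T0 ?h0//.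
  have : (0 < P)%N by rewrite PE -TL !muln_gt0 !expn_gt0 T0 h0.
  lia.
exists p; split => // s l sT lh.
have cT (i : 'I_d) : (count_mem i s < T)%N by exact: leq_ltn_trans (count_size _ _) sT.
rewrite -[RHS](pv ([ffun i => Ordinal (cT i)], Ordinal lh)).
apply: eq_bigr => k _; rewrite /c /= [RHS]mulrAC; congr (_ * _).
rewrite mulrC; congr (_ * _); rewrite /gamprod.
rewrite [RHS](eq_bigr (fun i => gam i k ^+ count_mem i s)) => [|i _]; last by rewrite ffunE.
elim: s {sT cT} => [|j s IHs]; first by rewrite big_nil big1.
rewrite big_cons IHs [RHS](bigD1 j)//= [in LHS](bigD1 j)//= eqxx exprD expr1 mulrA.
by congr (_ * _); apply: eq_bigr => i ij; rewrite eq_sym (negbTE ij).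
Qed.

End BakerFunction.

Lemma ln_pow2_bound (R : realType) (c y : nat) :
  (0 < c <= 2 ^ y)%N -> 0 <= ln (c%:R : R) <= y%:R.
Proof.
case/andP => c0 cB; rewrite ln_ge0 ?ler1n//=.
apply: (@le_trans _ _ (ln (2 ^+ y))).
  by rewrite ler_ln ?posrE ?ltr0n ?exprn_gt0// -natrX ler_nat.
rewrite lnXn// -[ln _ *+ _]mulr_natl ler_piMr//.
by have := @le_ln1Dx R 1; apply; lra.
Qed.

Section Extension.
Variables (R : realType) (d L a0 : nat) (a : 'I_d -> nat) (b0 : int) (b : 'I_d -> int).
Variables (ell y : nat).
Hypotheses (LE : L = (2 ^ ell)%N) (b0N : b0 != 0) (y0 : (0 < y)%N)
  (a0B : (0 < a0 <= 2 ^ y)%N) (aB : forall j, (0 < a j <= 2 ^ y)%N).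

Notation lam := (lam d L).
Notation monval := (monval a0 a).
Notation gam := (gam b0 b).
Notation gamprod := (gamprod b0 b).
Notation vanishing := (vanishing a0 a b0 b).

Definition linform : R := b0%:~R * ln a0%:R + \sum_j (b j)%:~R * ln (a j)%:R.

Let u (k : lam) : R := (k.1)%:R * ln a0%:R + \sum_j (k.2 j)%:R * ln (a j)%:R.
Let w (k : lam) : R := \sum_j (gam j k)%:~R * (ln (a j)%:R / b0%:~R).

Let b0R : b0%:~R != 0 :> R. Proof. by rewrite intr_eq0. Qed.

Lemma expR_u k l : expR (l%:R * u k) = (monval k)%:R ^+ l.
Proof.
rewrite expRM_natl; congr (_ ^+ _); rewrite /u expRD expR_sum /monval natrM natr_prod.
have e c (m : nat) : (0 < c <= 2 ^ y)%N -> expR (m%:R * ln c%:R) = (c ^ m)%:R :> R.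
  by case/andP => c0 _; rewrite expRM_natl lnK ?posrE ?ltr0n// natrX.
by rewrite e//; congr (_ * _); apply: eq_bigr => j _; rewrite e.
Qed.

Lemma u_sub_w k : u k - w k = (k.1)%:R * linform / b0%:~R.
Proof.
rewrite /u /w /linform mulrDr mulrDl -addrA; congr (_ + _); first by field.
rewrite mulr_sumr mulr_suml -sumrB; apply: eq_bigr => j _.
by rewrite /gam intrB !intrM; field.
Qed.

(** Expanding one factor [w k] in the [gam j k] lengthens s by one; thus t powers of w use up t of
    the available derivatives. *)
Lemma vanishing_wpow (p : lam -> int) D h s t l : vanishing p D h -> (size s + t < D)%N -> (l < h)%N ->
  \sum_k (p k)%:~R * (gamprod s k)%:~R * (w k ^+ t * (monval k)%:R ^+ l) = 0 :> R.
Proof.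
move=> van; elim: t s => [|t IHt] s sD lh.
  rewrite addn0 in sD.
  have := congr1 (fun z : int => z%:~R : R) (van s l sD lh); rewrite /= => E.
  rewrite -[RHS]E rmorph_sum/=; apply: eq_bigr => k _.
  by rewrite !intrM rmorphXn/= expr0 mul1r -pmulrn.
rewrite (eq_bigr (fun k => \sum_j (ln (a j)%:R / b0%:~R) * ((p k)%:~R *
    (gamprod (j :: s) k)%:~R * (w k ^+ t * (monval k)%:R ^+ l)))); last first.
  move=> k _; rewrite exprSr {2}/w mulr_sumr mulr_suml mulr_sumr.
  by apply: eq_bigr => j _; rewrite gamprod_cons intrM; ring.
rewrite exchange_big/= big1// => j _.
by rewrite -mulr_sumr IHt ?mulr0//= addSnnS.
Qed.

(** Of the 2T derivatives, fewer than T go into [gamprod s] and T serve as multiplicity for the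
    interpolation, whence the halving. The value at x is an integer of absolute value below 1, hence
    0. *)
Lemma vanishing_extend (p : lam -> int) h h' T v Z :
  (0 < h)%N -> (0 < T)%N -> vanishing p (2 * T) h ->
  (64 * (h' * (d.+1 * y * L)) <= h * T)%N ->
  (h' <= 2 ^ v)%N -> (T.+2 <= 2 ^ v)%N -> (d.+1 * y * L <= 2 ^ v)%N ->
  (4 * (v.+1 * (h * T).+1) <= Z)%N ->
  `|linform| <= (2 ^+ (Z + ell))^-1 ->
  (forall s, (size s < T)%N -> \sum_k `|p k * gamprod s k| <= (2 ^ (h * T))%N%:Z) ->
  vanishing p T h'.
Proof.
move=> h0 T0 van WB h'v Tv Wv ZB linB pB s x sT xh'.
have [xh|hx] := ltnP x h; first by apply: van => //; lia.
pose c k : R := (p k * gamprod s k)%:~R.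
have L0 : (0 < L)%N by rewrite LE expn_gt0.
have uwB k : `|u k - w k| <= (2 ^+ Z)^-1.
  rewrite u_sub_w normrM normfV ler_pdivrMr; last by rewrite normr_gt0.
  have b1 : 1 <= `|b0%:~R : R|.
    by rewrite -intr_norm -[1]/(1%:~R) ler_int; have := b0N; lia.
  apply: (@le_trans _ _ (2 ^+ Z)^-1); last by rewrite ler_peMr// invr_ge0 exprn_ge0.
  rewrite normrM normr_nat; apply: (@le_trans _ _ (2 ^+ ell * (2 ^+ (Z + ell))^-1)).
    by rewrite ler_pM// -natrX ler_nat -LE ltnW.
  by rewrite exprD invfM mulrCA mulfV ?mulr1// expf_neq0 ?pnatr_eq0.
have u0B k : `|u k| <= (d.+1 * y * L.-1)%:R.
  have lnB c' (m : 'I_L) : (0 < c' <= 2 ^ y)%N -> `|m%:R * ln (c'%:R : R)| <= (y * L.-1)%:R.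
    move=> /(ln_pow2_bound R)/andP[l0 lB].
    rewrite normrM normr_nat ger0_norm// mulnC natrM ler_pM// ler_nat.
    by have := ltn_ord m; lia.
  rewrite (le_trans (ler_normD _ _))// -mulnA mulSn natrD lerD//; first exact: lnB.
  rewrite (le_trans (ler_norm_sum _ _ _))//.
  rewrite natrM mulr_natl -[d in leRHS]card_ord -sumr_const.
  by apply: ler_sum => j _; apply: lnB.
have wB k : `|w k| <= (d.+1 * y * L)%:R.
  have -> : w k = u k - (u k - w k) by ring.
  rewrite (le_trans (ler_normB _ _))//.
  apply: (@le_trans _ _ ((d.+1 * y * L.-1)%:R + 1)).
    rewrite lerD// (le_trans (uwB k))// invf_le1 ?exprn_gt0//.
    by rewrite exprn_ege1// ler1n.
  rewrite natr1 ler_nat; have : (1 <= d.+1 * y)%N by rewrite muln_gt0.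
  by rewrite -(leq_add2r (d.+1 * y * L.-1)) add1n -mulnS prednK.
have cB : \sum_k `|c k| <= 2 ^+ (h * T).
  have := pB s sT; rewrite -(ler_int R) rmorph_sum/= -pmulrn natrX.
  by apply: le_trans; apply: ler_sum => k _; rewrite -intr_norm.
have W0 : (0 < d.+1 * y * L)%N by rewrite !muln_gt0 y0.
have xWB : (64 * (x * (d.+1 * y * L)) <= h * T)%N.
  apply: leq_trans WB; rewrite leq_mul2l/= leq_mul2r; lia.
have := @extrapolation_lt1 R lam c w u h T x _ v Z h0 hx T0 W0 wB uwB xWB.
have xv : (x <= 2 ^ v)%N by lia.
move=> /(_ xv Tv Wv ZB cB) H.
have := H _; rewrite (_ : \sum_i _ =
  (\sum_k p k * gamprod s k * (monval k)%:Z ^+ x)%:~R); last first.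
  by rewrite rmorph_sum/=; apply: eq_bigr => k _; rewrite expR_u intrM rmorphXn.
rewrite -intr_norm -[1]/(1%:~R) ltr_int => H'.
suff : `|\sum_k p k * gamprod s k * (monval k)%:Z ^+ x| < 1 by lia.
apply: H' => l t lh tT; rewrite -[RHS](@vanishing_wpow p (2 * T) h s t l)//; last by lia.
by apply: eq_bigr => k _; rewrite expR_u /c intrM.
Qed.

End Extension.

(* Put H = 2^e and T = H^2 L.  Starting from T derivatives at H points, where
   L^n = 2 T^d H makes Siegel's lemma apply, each extrapolation step multiplies
   the number of points by H and halves the number of derivatives.  After J0
   steps there are at least as many points as exponential functions. *)
Section Baker.
Variables (R : realType) (d a0 : nat) (a : 'I_d -> nat) (b0 : int) (b : 'I_d -> int).
Variables (beta y e : nat).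
Let n := d.+1.
Let J0 := (2 * n ^ 2).-1.
Hypotheses (y0 : (0 < y)%N) (b0N : b0 != 0)
  (b0B : `|b0| <= (2 ^ beta)%:Z) (bB : forall j, `|b j| <= (2 ^ beta)%:Z)
  (a0B : (0 < a0 <= 2 ^ y)%N) (aB : forall j, (0 < a j <= 2 ^ y)%N)
  (indep : forall (m0 m0' : nat) (m m' : 'I_d -> nat),
     (a0 ^ m0 * \prod_j a j ^ m j = a0 ^ m0' * \prod_j a j ^ m' j)%N ->
     m0 = m0' /\ forall j, m j = m' j)
  (eB : (2 ^ (J0 + 8) * (n * (beta + y + e * (2 * d + 1) + 4)) <= 2 ^ e)%N).

Let ell := (1 + e * (2 * d + 1))%N.
Let L := (2 ^ ell)%N.
Let D := (e * (2 * d + 3))%N.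

Let J0E : J0.+1 = (2 * n ^ 2)%N.
Proof. by rewrite /J0 prednK// muln_gt0 expn_gt0. Qed.

Let e_ge : (J0 + 8 <= e)%N.
Proof.
rewrite -(@leq_exp2l 2)//; apply: leq_trans eB; rewrite leq_pmulr// muln_gt0/=.
by rewrite addn_gt0 orbT.
Qed.

Let c1 : (64 * (2 ^ J0 * (n * (beta + y + e * (2 * d + 1) + 4))) <= 2 ^ e)%N.
Proof. by apply: leq_trans eB; rewrite addnC expnD; lia. Qed.

Let twoJ0 : (J0 < 2 ^ J0)%N. Proof. exact: ltn_expl. Qed.

Let DJ J : (J < J0)%N -> (J < D)%N.
Proof. by move=> JJ; rewrite /D; nia. Qed.

Let widen : (64 * (2 ^ J0 * (n * y)) <= 2 ^ e)%N.
Proof. by apply: leq_trans c1; rewrite !leq_mul2l/=; lia. Qed.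

(** At every stage, 2^J0 times the exponent on the right is at least 2^e 2^D. The exponents of the
    Siegel coefficients and of [gamprod] are of order Q 2^D with Q = n (beta + y + e (2d + 1) + 4),
    and [eB] makes 2^e exceed 2^J0 Q with room to spare. *)
Lemma baker_sizes J p : (J < J0)%N ->
  (forall k, `|p k| <= (2 * (L ^ d.+1 * 2 ^ ((beta + 1 + ell) * (d * 2 ^ D.+1)
     + y * (d.+1 * L) * 2 ^ e)))%N%:Z) ->
  forall s, (size s < 2 ^ (D - J))%N ->
  \sum_(k : lam d L) `|p k * gamprod b0 b s k| <= (2 ^ (2 ^ (e * J.+1) * 2 ^ (D - J)))%N%:Z.
Proof.
move=> JJ pB s sT.
set M := ((beta + 1 + ell) * (d * 2 ^ D.+1) + y * (d.+1 * L) * 2 ^ e)%N in pB.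
apply: (@le_trans _ _ (\sum_(k : lam d L)
   (2 * (L ^ d.+1 * 2 ^ M) * 2 ^ ((beta + 1 + ell) * 2 ^ D.+1))%N%:Z)).
  apply: ler_sum => k _; rewrite normrM PoszM ler_pM//.
  have gB := gamprod_bound (erefl L) b0B bB a0B s k.
  apply: (le_trans gB).
  rewrite lez_nat leq_exp2l// leq_mul2l (leq_trans (ltnW sT)) ?orbT// leq_exp2l//.
  by rewrite (leq_trans (leq_subr _ _)).
rewrite sumr_const card_prod card_ffun !card_ord -expnS -mulr_natl natz -PoszM lez_nat.
set K := ((beta + 1 + ell) * 2 ^ D.+1)%N.
have -> : (L ^ n * (2 * (L ^ n * 2 ^ M) * 2 ^ K) = 2 ^ (ell * n + (1 + (ell * n + M) + K)))%N.
  by rewrite /L -!expnM !expnD expn1; lia.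
rewrite leq_exp2l// /K {K}.
have T0 : (2 ^ D.+1 = 2 * (2 ^ e * 2 ^ e * 2 ^ (e * (2 * d + 1))))%N.
  by rewrite expnS -!expnD; congr (2 * 2 ^ _)%N; rewrite /D; lia.
have LE : (L = 2 * 2 ^ (e * (2 * d + 1)))%N by rewrite /L /ell expnD.
have big : (2 ^ e * 2 ^ D <= 2 ^ J0 * (2 ^ (e * J.+1) * 2 ^ (D - J)))%N.
  have := DJ JJ => JD.
  rewrite -!expnD leq_exp2l// mulnS.
  have : (J <= e * J)%N by rewrite leq_pmull// (leq_trans _ e_ge)// addnC.
  by move: JD; move: (e * J)%N D => eJ D'; clear; lia.
rewrite -(@leq_pmul2l (2 ^ J0)) ?expn_gt0//; apply: leq_trans big.
have g0 : (0 < 2 ^ (e * (2 * d + 1)))%N by rewrite expn_gt0.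
have h0 : (0 < 2 ^ e)%N by rewrite expn_gt0.
have TD : (2 ^ D = 2 ^ e * 2 ^ e * 2 ^ (e * (2 * d + 1)))%N.
  by move: T0; rewrite expnS; lia.
rewrite TD /M T0 LE /ell; move: c1; rewrite -/n.
move: g0 h0; clear; move: (e * (2 * d + 1))%N (2 ^ (e * (2 * d + 1)))%N (2 ^ e)%N (2 ^ J0)%N.
move=> t g H c g0 H0; set Q := (n * (beta + y + t + 4))%N => cQ.
have q1 : (n * (beta + 1 + (1 + t)) <= Q)%N by rewrite leq_mul2l; lia.
have q2 : (n * y <= Q)%N by rewrite leq_mul2l; lia.
have q3 : ((1 + t) * n <= Q)%N by rewrite mulnC leq_mul2l; lia.
have q4 : (1 <= Q)%N by rewrite muln_gt0/=; lia.
have HHg : (1 <= H * H * g)%N by rewrite !muln_gt0 H0 g0.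
apply: (@leq_trans (c * (7 * Q * (H * H * g)))).
  rewrite leq_mul2l; apply/orP; right.
  have e1 : ((1 + t) * n <= Q * (H * H * g))%N by apply: leq_trans q3 _; rewrite leq_pmulr.
  have e2 : (n * (beta + 1 + (1 + t)) * (H * H * g) <= Q * (H * H * g))%N by rewrite leq_mul2r q1 orbT.
  have e3 : (n * y * (g * H) <= Q * (H * H * g))%N.
    by apply: leq_mul => //; rewrite (mulnC g) leq_mul2r leq_pmulr ?orbT.
  have e4 : (1 <= Q * (H * H * g))%N by rewrite muln_gt0 q4.
  rewrite -/n in e1 e2 e3 *.
  have -> : ((beta + 1 + (1 + t)) * (d * (2 * (H * H * g))) = 2 * (d * (beta + 1 + (1 + t)) * (H * H * g)))%N by lia.
  have -> : ((beta + 1 + (1 + t)) * (2 * (H * H * g)) = 2 * ((beta + 1 + (1 + t)) * (H * H * g)))%N by lia.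
  have -> : (y * (n * (2 * g)) * H = 2 * (n * y * (g * H)))%N by lia.
  have {}e2 : (d * (beta + 1 + (1 + t)) * (H * H * g) + (beta + 1 + (1 + t)) * (H * H * g) <= Q * (H * H * g))%N.
    by apply: leq_trans e2; rewrite /n -mulnDl -mulSnr.
  rewrite -(mulnA 7); move: e1 e2 e3 e4; set X1 := (_ * n)%N; set X2 := (Q * _)%N.
  set X3 := (d * _ * _)%N; set X4 := (_ * (H * H * g))%N; set X5 := (_ * (g * H))%N.
  by clearbody X1 X2 X3 X4 X5; clear; lia.
have -> : (c * (7 * Q * (H * H * g)) = (7 * (c * Q)) * (H * H * g))%N by lia.
by rewrite leq_mul2r; apply/orP; right; lia.
Qed.

(** At all stages h T is at most 2^(e J0) 2^D, and two more factors 2^e cover v and the constants;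
    with J0 + 1 = 2n^2 and D = e (2n + 1) the exponents add up to e (2n^2 + 2n + 2). Subtracting
    [ell] pays for the factor k.1 < 2^ell in [u_sub_w]. *)
Let Z := (2 ^ (e * (2 * n ^ 2 + 2 * n + 2)) - ell)%N.

Lemma baker_Z_bound J : (J < J0)%N ->
  (4 * ((e * J0.+1 + D + 3).+1 * (2 ^ (e * J.+1) * 2 ^ (D - J)).+1) <= Z)%N.
Proof.
move=> JJ; rewrite /Z leq_subRL; last first.
  apply: (@leq_trans (2 ^ ell)); first exact/ltnW/ltn_expl.
  rewrite leq_exp2l// /ell /n; move: e_ge; clear; nia.
have q : (64 * (e * J0.+1 + D + 3).+1 <= 8 * 2 ^ e)%N.
  move: c1 twoJ0; rewrite /D; move: (2 ^ J0)%N J0 (2 ^ e)%N => c j H; rewrite /n.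
  clear; nia.
have ellH : (ell <= 2 ^ e)%N.
  move: c1 twoJ0; rewrite /ell; move: (2 ^ J0)%N J0 (2 ^ e)%N => c j H; rewrite /n.
  clear; nia.
set X := (2 ^ (e * J0) * 2 ^ D)%N.
have XB : (2 ^ (e * J.+1) * 2 ^ (D - J) <= X)%N.
  by rewrite leq_mul// leq_exp2l// ?leq_mul2l ?JJ ?orbT// leq_subr.
have X1 : (1 <= X)%N by rewrite muln_gt0 !expn_gt0.
have H1 : (0 < 2 ^ e)%N by rewrite expn_gt0.
have X2 : (X * 2 ^ e * 2 ^ e <= 2 ^ (e * (2 * n ^ 2 + 2 * n + 2)))%N.
  rewrite /X -!expnD leq_exp2l// /D -J0E /n; clear; lia.
apply: leq_trans X2; have H16 : (16 <= 2 ^ e)%N.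
  by rewrite (@leq_exp2l 2 4)//; move: e_ge; clear; lia.
move: q ellH XB X1 H1 H16; move: (_ * 2 ^ (D - J))%N (e * _ + _ + _).+1 ell X (2 ^ e)%N.
clear; move=> N v l X H q lH NX X1 H1 H16.
apply: (@leq_trans (H + H * (2 * X))); last first.
  apply: (@leq_trans (X * H * 16)); last by rewrite leq_mul2l H16 orbT.
  nia.
rewrite leq_add//; apply: (@leq_trans (H * N.+1)); last by rewrite leq_mul2l; lia.
by rewrite mulnA leq_mul2r; lia.
Qed.

Lemma baker : (2 ^+ (2 ^ (e * (2 * n ^ 2 + 2 * n + 2))))^-1 < `|linform R a0 a b0 b|.
Proof.
rewrite ltNge; apply/negP => small.
have ellZ : (Z + ell = 2 ^ (e * (2 * n ^ 2 + 2 * n + 2)))%N.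
  rewrite /Z subnK//; apply: (@leq_trans (2 ^ ell)); first exact/ltnW/ltn_expl.
  rewrite leq_exp2l// /ell /n; move: e_ge; clear; nia.
have [|||p [[k0 pk0] pB van]] := exists_vanishing (erefl L) b0B bB a0B aB
    (h := 2 ^ e) (T := 2 ^ D.+1) _ _ _ (erefl _).
- by rewrite expn_gt0.
- by rewrite expn_gt0.
- rewrite -expnM -expnD -[X in (X * _)%N]/(2 ^ 1)%N -expnD -expnM.
  by congr (2 ^ _)%N; rewrite /D /ell; clear; lia.
have e0 : (0 < e)%N by move: e_ge; clear; lia.
have stages J : (J <= J0)%N ->
    vanishing a0 a b0 b p (2 ^ (D.+1 - J)) (2 ^ (e * J.+1)).
  elim: J => [_|J IHJ JJ]; first by rewrite subn0 muln1.
  have JD := DJ JJ.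
  apply: (vanishing_extend (R := R) (h := 2 ^ (e * J.+1)) (v := e * J0.+1 + D + 3) (Z := Z)
    (erefl L) b0N y0 a0B aB) => //.
  - by rewrite expn_gt0.
  - by rewrite expn_gt0.
  - by rewrite -expnS subnSK ?ltnS 1?ltnW//; exact: IHJ (ltnW JJ).
  - rewrite subSS.
    have E : (2 ^ D = 2 ^ e * 2 ^ e * 2 ^ (e * (2 * d + 1)))%N.
      by rewrite -!expnD; congr (2 ^ _)%N; rewrite /D; clear; lia.
    have E2 : (2 ^ D = 2 ^ J * 2 ^ (D - J))%N by rewrite -expnD subnKC// ltnW.
    have E3 : (L = 2 * 2 ^ (e * (2 * d + 1)))%N by rewrite /L /ell expnD.
    have E4 : (2 ^ (e * J.+2) = 2 ^ e * 2 ^ (e * J.+1))%N by rewrite -expnD -mulnS.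
    have E5 : (2 * 2 ^ J <= 2 ^ J0)%N by rewrite -expnS leq_exp2l.
    rewrite -(@leq_pmul2l (2 ^ J)) ?expn_gt0// (mulnCA _ (2 ^ (e * J.+1))%N) -E2 E E3 E4.
    have w2 : (64 * (2 * 2 ^ J * (n * y)) <= 2 ^ e)%N.
      by apply: leq_trans widen; rewrite leq_mul2l leq_mul2r E5 orbT.
    move: w2; move: (2 ^ J)%N (2 ^ e)%N (2 ^ (e * _))%N (2 ^ (e * J.+1))%N => c H g G w2.
    have -> : (c * (64 * (H * G * (d.+1 * y * (2 * g)))) = 64 * (2 * c * (n * y)) * (G * (H * g)))%N.
      by rewrite /n; clear; lia.
    have -> : (G * (H * H * g) = H * (G * (H * g)))%N by clear; lia.
    by rewrite leq_mul2r w2 orbT.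
  - rewrite leq_exp2l//; apply: (@leq_trans (e * J0.+1)); last by clear; lia.
    by rewrite leq_mul2l ltnS JJ orbT.
  - apply: (@leq_trans (2 ^ (D + 2))); last by rewrite leq_exp2l//; clear; lia.
    rewrite expnD; apply: (@leq_trans (2 ^ D + 2)).
      by rewrite -addn2 leq_add2r leq_exp2l// subSS leq_subr.
    by have : (0 < 2 ^ D)%N by [rewrite expn_gt0]; move: (2 ^ D)%N; clear; lia.
  - apply: (@leq_trans (2 ^ e * L)).
      rewrite leq_mul2r; apply/orP; right; apply: leq_trans widen.
      by rewrite -/n mulnA leq_pmull// muln_gt0 expn_gt0.
    rewrite /L -expnD leq_exp2l// /ell /D; move: e0; clear; nia.
  - by rewrite subSS baker_Z_bound.
  - by rewrite ellZ.
  - by rewrite subSS; apply: baker_sizes.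
have := stages J0 (leqnn _).
rewrite J0E => vanf.
(* For the empty sequence the relations form a Vandermonde system in the numbers [monval], which are
   distinct by [indep]. The 2^(2 e n^2) points suffice for the L^n = 2^(n + e n (2n - 1)) functions;
   this is what determines J0. *)
have pR0 : forall k, (p k)%:~R = 0 :> rat.
  apply: (@power_sums_eq0 _ _ (fun k => (monval a0 a k)%:R)).
    move=> k k' /eqP; rewrite eqr_nat => /eqP kk'.
    have [k1 k2] := indep kk'.
    case: k k' k1 k2 {kk'} => [k1 k2] [k1' k2'] /= e1 e2; congr (_, _); first exact: val_inj.
    by apply/ffunP => j; apply: val_inj; rewrite /= e2.
  move=> l lI; have := vanf [::] l.
  rewrite expn_gt0/= => /(_ isT) H.
  have lL : (l < 2 ^ (e * (2 * n ^ 2)))%N.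
    apply: (leq_trans lI); rewrite card_prod card_ffun !card_ord -expnS /L -expnM leq_exp2l//.
    rewrite /ell -/n; move: e_ge; rewrite -(leq_add2r 1) -addnA addn1.
    have -> : (J0 + (8 + 1) = J0.+1 + 8)%N by clear; lia.
    rewrite J0E /n; clear; nia.
  have := congr1 (fun z : int => z%:~R : rat) (H lL); rewrite /= => E.
  rewrite -[RHS]E rmorph_sum/=; apply: eq_bigr => k _.
  by rewrite /gamprod big_nil mulr1 intrM rmorphXn/= -pmulrn.
by have /eqP := pR0 k0; rewrite intr_eq0 (negbTE pk0).
Qed.

End Baker.

Local Close Scope ring_scope.

(** * Prime factors and the sum of divisors *)

Definition repunit (r q : nat) : nat := \sum_(j < r) q ^ j.

Lemma repunitE r q : 0 < q -> (q.-1 * repunit r q).+1 = q ^ r.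
Proof.
move=> q0; rewrite /repunit; elim: r => [|r IHr]; first by rewrite big_ord0 muln0.
by rewrite big_ord_recr/= mulnDr -addSn IHr expnS -mulSn prednK.
Qed.

Lemma repunitM r s q : repunit (r * s) q = repunit r q * repunit s (q ^ r).
Proof.
rewrite /repunit; elim: s => [|s IHs]; first by rewrite muln0 !big_ord0 muln0.
rewrite mulnS addnC big_split_ord/= IHs big_ord_recr/= mulnDr; congr (_ + _).
rewrite -expnM big_distrl/=; apply: eq_bigr => j _.
by rewrite expnD mulnC.
Qed.

Lemma sigma_gt0 n : 0 < n -> 0 < sigma n.
Proof.
move=> n0; rewrite /sigma (big_rem n) ?divisors_id//=.
by rewrite addn_gt0 n0.
Qed.

Lemma sigma_pfactor q f m : prime q -> 0 < m -> ~~ (q %| m) ->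
  sigma (q ^ f * m) = repunit f.+1 q * sigma m.
Proof.
move=> qp m0 qm; have q0 := prime_gt0 qp; have q1 := prime_gt1 qp.
have n0 : 0 < q ^ f * m by rewrite muln_gt0 expn_gt0 q0.
have cop x : x %| m -> coprime q x.
  by move=> xm; rewrite prime_coprime//; apply: contra qm => /dvdn_trans; apply.
rewrite /sigma (perm_big [seq q ^ j * x | j <- iota 0 f.+1, x <- divisors m]).
  rewrite big_allpairs_dep/= /repunit -(big_mkord xpredT (fun j => q ^ j)).
  by rewrite /index_iota subn0 big_distrl/=; apply: eq_bigr => j _; rewrite big_distrr.
apply: uniq_perm; first exact: divisors_uniq.
  apply: allpairs_uniq; rewrite ?iota_uniq ?divisors_uniq//.
  move=> [j x] [j' x'] /allpairsPdep[j1 [x1 [_ xm [-> ->]]]] /allpairsPdep[j2 [x2 [_ xm' [-> ->]]]] /=.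
  rewrite -!dvdn_divisors// in xm xm'.
  move=> E; have := congr1 (logn q) E.
  have x0 := dvdn_gt0 m0 xm; have x0' := dvdn_gt0 m0 xm'.
  rewrite !lognM ?expn_gt0 ?q0// !pfactorK// !logn_coprime ?cop// !addn0 => jj.
  by move: E; rewrite jj => /eqP; rewrite eqn_pmul2l ?expn_gt0 ?q0// => /eqP->.
move=> x; rewrite -dvdn_divisors//; apply/idP/allpairsPdep => [xn|[j [z [jf zm ->]]]].
  have x0 := dvdn_gt0 n0 xn.
  exists (logn q x), (x %/ q ^ logn q x); split; last by rewrite mulnC divnK ?pfactor_dvdnn.
    rewrite mem_iota/= add0n ltnS.
    have := dvdn_leq_log q n0 xn.
    by rewrite lognM ?expn_gt0 ?q0// pfactorK// (logn_coprime (cop _ (dvdnn m))) addn0.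
  rewrite -dvdn_divisors//.
  have cz : coprime (x %/ q ^ logn q x) (q ^ f).
    rewrite coprime_sym coprimeXl// prime_coprime// -{1}(expn1 q) pfactor_dvdn ?divn_gt0 ?expn_gt0 ?q0//.
      rewrite logn_div ?pfactor_dvdnn// pfactorK// subnn//.
    by rewrite dvdn_leq// pfactor_dvdnn.
  rewrite -(Gauss_dvdr m cz) (dvdn_trans _ xn)//.
  by apply/dvdnP; exists (q ^ logn q x); rewrite mulnC divnK// pfactor_dvdnn.
rewrite mem_iota add0n ltnS /= in jf; rewrite -dvdn_divisors// in zm.
by rewrite dvdn_mul// dvdn_exp2l.
Qed.

Lemma repunit_dvd_sigma N q : 0 < N -> prime q ->
  repunit (logn q N).+1 q %| sigma N.
Proof.
move=> N0 qp; have [m qm NE] := pfactor_coprime qp N0.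
rewrite {2}NE mulnC sigma_pfactor ?dvdn_mulr// -?prime_coprime//.
by move: N0; rewrite {1}NE muln_gt0 => /andP[].
Qed.

(** For a prime power, sigma(q^f)/q^f = (q^(f+1) - 1)/((q - 1) q^f) < q/(q - 1); the induction
    strips off one prime, with denominators cleared. *)
Lemma sigma_le_prod N : 0 < N ->
  sigma N * \prod_(p <- primes N) p.-1 <= N * \prod_(p <- primes N) p.
Proof.
elim/ltn_ind: N => N IHN N0; have [N1|N1] := leqP N 1.
  have -> : N = 1 by lia.
  by rewrite /sigma (_ : divisors 1 = [:: 1])// (_ : primes 1 = [::])// big_seq1 !big_nil.
have qp := pdiv_prime N1; set q := pdiv N in qp.
have [m qm NE] := pfactor_coprime qp N0; set f := logn q N in NE.
have q0 := prime_gt0 qp; have q1 := prime_gt1 qp.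
have m0 : 0 < m by move: N0; rewrite {1}NE muln_gt0 => /andP[].
have f0 : 0 < f by rewrite logn_gt0 mem_primes qp N0 pdiv_dvd.
have mN : m < N by rewrite NE ltn_Pmulr// -{1}(expn0 q) ltn_exp2l.
have qm' : ~~ (q %| m) by rewrite -prime_coprime.
have pE : perm_eq (primes N) (q :: primes m).
  apply: uniq_perm; rewrite ?primes_uniq//=.
    by rewrite primes_uniq andbT mem_primes negb_and negb_and qm' !orbT.
  move=> p; rewrite in_cons !mem_primes N0 m0/= {1}NE.
  case: (boolP (prime p)) => pp /=; last first.
    by apply/esym/negbTE; rewrite negb_or andbT; apply: contra pp => /eqP->.
  by rewrite Euclid_dvdM// Euclid_dvdX// f0 andbT (dvdn_prime2 pp qp) orbC.
rewrite !(perm_big _ pE)/= !big_cons {1}NE (mulnC m) sigma_pfactor//.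
have := IHN _ mN m0; have := repunitE f.+1 q0.
set s := sigma m; set A := \prod_(p <- _) _; set B := \prod_(p <- _) _.
move=> rE H; rewrite [X in _ <= X * _]NE.
have -> : repunit f.+1 q * s * (q.-1 * A) = (q.-1 * repunit f.+1 q) * (s * A) by lia.
have -> : m * q ^ f * (q * B) = q ^ f.+1 * (m * B) by rewrite expnS; lia.
by rewrite leq_mul// -rE leqnSn.
Qed.

(** The largest of n distinct integers above 1 is at least n + 1, so its factor x/(x - 1) is at most
    (n + 1)/n; removing it and repeating telescopes. *)
Lemma prod_le_pred_prod (s : seq nat) : uniq s -> all (fun x => 1 < x) s ->
  \prod_(x <- s) x <= (size s).+1 * \prod_(x <- s) x.-1.
Proof.
elim: {s}(size s) {-2}s (erefl (size s)) => [|n IHn] s sn us s1.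
  by rewrite (size0nil sn) !big_nil.
have [m ms mP] : exists2 m, m \in s & forall x, x \in s -> x <= m.
  case: s sn us s1 => // x0 s sn us s1.
  have [] := @arg_maxnP _ (ord0 : 'I_(size s).+1) xpredT (fun i => nth 0 (x0 :: s) i) isT.
  move=> i _ iP; exists (nth 0 (x0 :: s) i); first exact: mem_nth.
  move=> x xs; have ix : index x (x0 :: s) < (size s).+1 by rewrite -index_mem in xs.
  by have := iP (Ordinal ix) isT; rewrite /= nth_index.
have mn : n.+1 < m.
  have : size s <= size (iota 2 m.-1).
    apply: uniq_leq_size => // x xs; rewrite mem_iota.
    have := mP x xs; have := allP s1 x xs; lia.
  by rewrite sn size_iota; have := allP s1 m ms; lia.
have pE := perm_to_rem ms; rewrite !(perm_big _ pE) !big_cons.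
have := IHn (rem m s) _ (rem_uniq _ us) _; rewrite size_rem// sn => /(_ erefl).
have -> : all (fun x => 1 < x) (rem m s).
  by apply/allP => x /mem_rem xs; exact: (allP s1).
move=> /(_ isT); set A := \prod_(x <- _) x; set B := \prod_(x <- _) _ => H.
apply: (@leq_trans (m * (n.+1 * B))); first by rewrite leq_mul2l H orbT.
have -> : m * (n.+1 * B) = m * n.+1 * B by lia.
rewrite mulnA leq_mul2r; apply/orP; right; nia.
Qed.

(** Weierstrass' product inequality; the induction also carries that the product stays in [0, 1]. *)
Lemma le_prod_1sub (R : realDomainType) (T : Type) (s : seq T) (P : pred T) (x : T -> R) :
  (forall i, 0 <= x i <= 1)%R ->
  (1 - \sum_(i <- s | P i) x i <= \prod_(i <- s | P i) (1 - x i))%R.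
Proof.
move=> x01; suff [] : (1 - \sum_(i <- s | P i) x i <= \prod_(i <- s | P i) (1 - x i) /\
  0 <= \prod_(i <- s | P i) (1 - x i) <= 1)%R by [].
elim: s => [|i s [IH1 IH2]]; first by rewrite !big_nil subr0 ler01 lexx.
rewrite !big_cons; case: (P i) => //; have := x01 i.
move: IH1 IH2; move: (\sum_(i <- s | _) _)%R (\prod_(i <- s | _) _)%R (x i) => S Pr z.
move=> h1 /andP[h2 h3] /andP[h4 h5]; split; first nra.
by apply/andP; split; nra.
Qed.

(* 1/(i(i+1)) per dyadic block makes the sum over blocks telescope. *)
Lemma sum_inv_blocks (s : seq nat) (I0 M : nat) : 0 < I0 -> I0 <= M ->
  (forall i, I0 <= i -> count (fun q => trunc_log 2 q == i) s * (i * i.+1) <= 2 ^ i) ->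
  (\sum_(q <- s | (I0 <= trunc_log 2 q < M)%N) (q%:R)^-1 <= I0%:R^-1 - M%:R^-1 :> rat)%R.
Proof.
move=> I00; elim: M => [|M IHM]; first by move: I00; case: I0.
rewrite leq_eqVlt => /predU1P[<- _|].
  by rewrite subrr big_pred0// => q; apply/negbTE; lia.
rewrite ltnS => IM H; have h1 := IHM IM H.
rewrite (bigID (fun q => trunc_log 2 q == M))/=.
have M0 : 0 < M by exact: leq_trans I00 IM.
have -> : (I0%:R^-1 - M.+1%:R^-1 = (M * M.+1)%:R^-1 + (I0%:R^-1 - M%:R^-1) :> rat)%R.
  have m1 : (M%:R != 0 :> rat)%R by rewrite pnatr_eq0 -lt0n.
  have m2 : (1 + M%:R != 0 :> rat)%R by rewrite nat1r pnatr_eq0.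
  have m3 : (I0%:R != 0 :> rat)%R by rewrite pnatr_eq0 -lt0n.
  by rewrite natrM; field; rewrite m1 m2 m3.
apply: lerD.
  apply: (@le_trans _ _ ((count (fun q => trunc_log 2 q == M) s)%:R / (2 ^ M)%:R)%R).
    rewrite -sum1_count natr_sum mulr_suml big_mkcond [leRHS]big_mkcond/=.
    rewrite !big_seq; apply: ler_sum => q _.
    case: eqP => [qM|]; last by rewrite andbF.
    rewrite andbT; case: ifP => _; last by rewrite mulr_ge0 ?invr_ge0.
    have [->|q0] := posnP q; first by rewrite invr0 mul1r invr_ge0.
    rewrite mul1r lef_pV2 ?posrE ?ltr0n ?expn_gt0// ler_nat -qM.
    by have := trunc_log_bounds (isT : 1 < 2) q0 => /andP[].
  rewrite ler_pdivrMr ?ltr0n ?expn_gt0// ler_pdivlMl ?ltr0n ?muln_gt0 ?M0//.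
  by rewrite -natrM ler_nat mulnC H.
apply: le_trans h1; rewrite le_eqVlt; apply/orP; left; apply/eqP.
by apply: eq_bigl => q; lia.
Qed.

(** Fewer than 2^I0 primes lie below 2^I0, and they contribute at most 2^I0 to the product of q/(q -
    1). The others have reciprocal sum at most 1/I0 <= 1/2 and contribute at most 2. *)
Lemma sigma_bound (N I0 : nat) : 1 < I0 -> 0 < N ->
  (forall i, I0 <= i -> count (fun q => trunc_log 2 q == i) (primes N) * (i * i.+1) <= 2 ^ i) ->
  sigma N <= 2 ^ I0.+1 * N.
Proof.
move=> I01 N0 H; have I00 := ltnW I01.
set s := primes N in H.
pose S q := I0 <= trunc_log 2 q.
have s2 q : q \in s -> 1 < q by rewrite mem_primes => /andP[/prime_gt1].
have ptail : \prod_(q <- s | S q) q <= 2 * \prod_(q <- s | S q) q.-1.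
  pose M := (\max_(q <- s) trunc_log 2 q).+1.
  have MP q : q \in s -> trunc_log 2 q < M by move=> qs; rewrite ltnS leq_bigmax_seq.
  have sumB : (\sum_(q <- s | S q) (q%:R)^-1 <= 2^-1 :> rat)%R.
    have := @sum_inv_blocks s I0 (maxn I0 M) I00 (leq_maxl _ _) H => h.
    apply: (@le_trans _ _ (I0%:R^-1)%R); last by rewrite lef_pV2 ?posrE ?ltr0n// ler_nat.
    have E : (\sum_(q <- s | S q) (q%:R)^-1 = \sum_(q <- s | (I0 <= trunc_log 2 q < maxn I0 M)%N) (q%:R)^-1 :> rat)%R.
      rewrite [LHS]big_seq_cond [RHS]big_seq_cond.
      apply: eq_bigl => q; case: (boolP (q \in s)) => //= qs.
      by rewrite /S leq_max (MP q qs) orbT andbT.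
    by rewrite E (le_trans h)// gerBl invr_ge0.
  have x01 (q : nat) : (0 <= ((q%:R)^-1 : rat) <= 1)%R.
    case: q => [|q]; first by rewrite invr0 lexx ler01.
    by rewrite invr_ge0 ler0n invf_le1 ?ler1n ?ltr0n.
  have := le_prod_1sub s S x01.
  have -> : (\prod_(q <- s | S q) (1 - (q%:R)^-1) =
    (\prod_(q <- s | S q) q.-1)%:R / (\prod_(q <- s | S q) q)%:R :> rat)%R.
    rewrite !natr_prod -prodf_div [LHS]big_seq_cond [RHS]big_seq_cond; apply: eq_bigr => q /andP[qs _].
    have q1 := s2 q qs.
    have qn : (q%:R != 0 :> rat)%R by rewrite pnatr_eq0; lia.
    have -> : (q%:R = q.-1%:R + 1 :> rat)%R by rewrite natr1 prednK// ltnW.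
    by field; rewrite natr1 prednK// ltnW.
  have P0 : (0 < (\prod_(q <- s | S q) q)%:R :> rat)%R.
    by rewrite ltr0n big_seq_cond prodn_cond_gt0// => q /andP[/s2/ltnW].
  rewrite ler_pdivlMr// => h; rewrite -(ler_nat rat) natrM.
  move: h sumB P0; move: (\sum_(q <- s | _) _)%R (_%:R)%R (_%:R)%R => a x y h ha x0.
  nra.
have phead : \prod_(q <- s | ~~ S q) q <= 2 ^ I0 * \prod_(q <- s | ~~ S q) q.-1.
  rewrite -[X in X <= _]big_filter -[X in _ <= _ * X]big_filter; set t := [seq q <- s | ~~ S q].
  have ut : uniq t by rewrite filter_uniq// primes_uniq.
  have t1 : all (fun x => 1 < x) t.
    by apply/allP => q; rewrite mem_filter => /andP[_ /s2].
  apply: leq_trans (prod_le_pred_prod ut t1) _; rewrite leq_mul2r; apply/orP; right.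
  have : size t <= size (iota 1 (2 ^ I0).-1).
    apply: uniq_leq_size => // q; rewrite mem_filter mem_iota => /andP[nS qs].
    have q1 := s2 q qs; rewrite ltnW//= add1n prednK ?expn_gt0//.
    rewrite ltnNge; apply: contra nS => qI.
    by rewrite /S -(trunc_expnK I0 (isT : 1 < 2)) leq_trunc_log.
  by rewrite size_iota; have : 0 < 2 ^ I0 by [rewrite expn_gt0]; lia.
have := sigma_le_prod N0; rewrite -/s.
rewrite (bigID S)/= [X in _ <= _ * X](bigID S)/=.
have A0 : 0 < \prod_(q <- s | S q) q.-1.
  by rewrite big_seq_cond prodn_cond_gt0// => q /andP[/s2]; case: q => [|[]].
have B0 : 0 < \prod_(q <- s | ~~ S q) q.-1.
  by rewrite big_seq_cond prodn_cond_gt0// => q /andP[/s2]; case: q => [|[]].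
move: A0 B0 ptail phead.
move: (\prod_(q <- s | S q) q.-1) (\prod_(q <- s | ~~ S q) q.-1).
move: (\prod_(q <- s | S q) q) (\prod_(q <- s | ~~ S q) q).
move=> C D A B A0 B0 CA DB h.
rewrite -(@leq_pmul2r (A * B)) ?muln_gt0 ?A0//; apply: leq_trans h _.
apply: (@leq_trans (N * ((2 * A) * (2 ^ I0 * B)))); first by rewrite leq_mul2l leq_mul ?orbT.
by rewrite expnS; lia.
Qed.

(** If r > p, then r is coprime to p - 1, so q^r = q^(p-1) = 1 mod p forces q = 1 mod p. The repunit
    is then r mod p, and p would divide the prime r. *)
Lemma prime_dvd_repunit_ge p q r : prime p -> prime r -> 0 < q ->
  p %| repunit r q -> r <= p.
Proof.
move=> pp rp q0 pQ; rewrite leqNgt; apply/negP => pr.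
have p1 := prime_gt1 pp; have pm0 : 0 < p.-1 by lia.
have qr : q ^ r = 1 %[mod p].
  by rewrite -(repunitE r q0) -addn1 -modnDml (eqP (dvdn_mull _ pQ)).
have pq : coprime q p.
  rewrite coprime_sym prime_coprime//; apply/negP => pq.
  move: qr; rewrite -(prednK (prime_gt0 rp)) expnS -modnMml (eqP pq) mul0n mod0n modn_small//.
have qp : q ^ p.-1 = 1 %[mod p].
  by rewrite -(totient_prime pp); exact: Euler_exp_totient.
have q1 : q = 1 %[mod p].
  have cop : coprime r p.-1.
    by rewrite prime_coprime//; apply/negP => /(dvdn_leq pm0); lia.
  have [[u v] /= uv] := coprimeP p.-1 (prime_gt0 rp) cop.
  have uvE : u * r = v * p.-1 + 1 by lia.
  have : q ^ (u * r) = 1 %[mod p] by rewrite (mulnC u) expnM -modnXm qr modnXm exp1n.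
  rewrite uvE expnD expn1 (mulnC v) expnM => <-.
  by rewrite -modnMml -modnXm qp modnXm exp1n modnMml mul1n.
have Qr : repunit r q = r %[mod p].
  rewrite /repunit; elim: (r) => [|r' IH]; first by rewrite big_ord0.
  rewrite big_ord_recr/= -modnDml IH modnDml -modnDmr -modnXm q1 modnXm exp1n modnDmr addn1 //.
have : p %| r by rewrite /dvdn -Qr.
by rewrite dvdn_prime2// => /eqP e; rewrite e ltnn in pr.
Qed.

(** * Multiplicatively independent shifted primes *)

Local Open Scope ring_scope.

(* Multiplicative independence, read on the vectors of p-adic valuations. *)
Definition mult_indep (k : nat) (z : 'I_k -> nat) :=
  forall c : 'I_k -> int,
    (forall p, \sum_i c i * (logn p (z i))%:Z = 0) -> forall i, c i = 0.

Lemma logn_lt_exp2 p z y : (0 < z < 2 ^ y)%N -> (logn p z < y)%N.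
Proof.
case/andP => z0 zy; have [pp|np] := boolP (prime p); last first.
  by rewrite lognE (negbTE np)/=; case: y zy => //; rewrite expn0; case: z z0.
rewrite -(@ltn_exp2l 2)//; apply: leq_ltn_trans zy.
apply: (@leq_trans (p ^ logn p z)); last by rewrite dvdn_leq// pfactor_dvdnn.
by case: (logn p z) => // l; rewrite leq_exp2r// prime_gt1.
Qed.

(** The rows of the matrix [A] are valuation vectors, so rank above k gives k + 1 independent ones.
    If the rank were at most k, at most k columns would determine each row; their entries are below
    y, which leaves at most y^k rows for the m distinct numbers z i. *)
Lemma mult_indep_select (k m y : nat) (z : 'I_m -> nat) :
  injective z -> (forall i, 0 < z i < 2 ^ y)%N -> (y ^ k < m)%N ->
  exists2 f : 'I_k.+1 -> 'I_m, injective f & mult_indep (fun i => z (f i)).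
Proof.
move=> z_inj zB mk.
have y0 : (0 < y)%N.
  have m0 : (0 < m)%N by exact: leq_ltn_trans mk.
  by have := logn_lt_exp2 2 (zB (Ordinal m0)); case: (y).
pose A : 'M[rat]_(m, 2 ^ y) := \matrix_(i, j) (logn j (z i))%:R.
have [rk|rk] := ltnP k (\rank A).
  pose f (i : 'I_k.+1) := maxrankfun A (widen_ord rk i).
  have f_inj : injective f.
    by move=> i i' /maxrankfun_inj /(congr1 val) /= e; apply: val_inj.
  exists f => // c cE.
  pose c' : 'rV[rat]_(\rank A) :=
    \sum_i (c i)%:~R *: delta_mx 0 (widen_ord rk i).
  have c'0 : c' *m rowsub (maxrankfun A) A = 0.
    rewrite /c' mulmx_suml; apply/rowP => p; rewrite summxE mxE.
    have := congr1 (fun u : int => u%:~R : rat) (cE p); rewrite /= rmorph_sum/= => E.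
    rewrite -[RHS]E; apply: eq_bigr => i _.
    by rewrite -scalemxAl -rowE !mxE intrM.
  have /row_freeP[B AB] : row_free (rowsub (maxrankfun A) A).
    exact: maxrowsub_free.
  have c0 : c' = 0 by rewrite -[LHS]mulmx1 -AB mulmxA c'0 mul0mx.
  move=> i; have /rowP/(_ (widen_ord rk i)) := c0.
  rewrite summxE (bigD1 i)//= big1 ?addr0 => [|j ji].
    by rewrite !mxE !eqxx mulr1 => /eqP; rewrite intr_eq0 => /eqP.
  rewrite !mxE eqxx/= -val_eqE/= val_eqE eq_sym (negbTE ji) mulr0 //.
exfalso.
(* Working on the transpose, [g] selects columns of [A] that span its column space. *)
pose g := maxrankfun A^T.
have gr : (\rank A^T <= k)%N by rewrite mxrank_tr.
have rowA i i' : (forall j, A i (g j) = A i' (g j)) -> i = i'.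
  move=> E.
  have [D AD] : exists D, A^T = D *m rowsub g A^T.
    by apply/submxP; rewrite eq_maxrowsub.
  have {}E p : A i p = A i' p.
    have -> : A = (rowsub g A^T)^T *m D^T by rewrite -trmx_mul -AD trmxK.
    rewrite !mxE; apply: eq_bigr => j _; congr (_ * _).
    by rewrite !mxE; have := E j; rewrite !mxE.
  apply: z_inj; have /andP[zi _] := zB i; have /andP[zi' _] := zB i'.
  apply: eqn_from_log => // p.
  have [py|py] := ltnP p (2 ^ y).
    by have := E (Ordinal py); rewrite !mxE => /eqP; rewrite eqr_nat => /eqP.
  have l0 j : logn p (z j) = 0%N.
    apply/eqP; rewrite -leqn0 leqNgt logn_gt0 mem_primes; apply/negP => /and3P[_ zj pz].
    by have := dvdn_leq zj pz; have := zB j; lia.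
  by rewrite !l0.
pose F (i : 'I_m) := [ffun j => inord (logn (g j) (z i)) : 'I_y.-1.+1].
have F_inj : injective F.
  move=> i i' /ffunP E; apply: rowA => j; have := E j; rewrite !ffunE.
  move/(congr1 val); rewrite /= !inordK ?prednK ?logn_lt_exp2// => e.
  by rewrite !mxE e.
have := leq_card F F_inj; rewrite card_ffun !card_ord prednK// => h.
have := leq_trans mk h; rewrite ltnNge => /negP; apply.
by rewrite leq_pexp2l.
Qed.

Lemma logn_prod_exp (k p : nat) (x m : 'I_k -> nat) : (forall i, 0 < x i)%N ->
  logn p (\prod_i x i ^ m i) = (\sum_i m i * logn p (x i))%N.
Proof.
move=> x0; suff [] : (0 < \prod_i x i ^ m i)%N /\
  logn p (\prod_i x i ^ m i) = (\sum_i m i * logn p (x i))%N by [].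
apply: (big_ind2 (fun u v => 0 < u /\ logn p u = v)%N); rewrite ?logn1//.
  by move=> u v u' v' [u0 <-] [u0' <-]; rewrite muln_gt0 u0 u0' lognM.
by move=> i _; rewrite expn_gt0 x0 lognX.
Qed.

(** The range m may exceed n, so that several numbers share one summation range and a relation
    between valuations passes to logarithms. Indices that are not prime contribute 0. *)
Lemma ln_nat_logn (R : realType) (n m : nat) : (0 < n <= m)%N ->
  ln (n%:R : R) = \sum_(p < m.+1) (logn p n)%:R * ln p%:R.
Proof.
case/andP => n0 nm; rewrite -{1}(partnT n0) (widen_partn _ nm) big_mkord.
suff [] : (0 < \prod_(p < m.+1) p ^ logn p n)%N /\
  ln ((\prod_(p < m.+1) p ^ logn p n)%N%:R : R) = \sum_(p < m.+1) (logn p n)%:R * ln p%:R.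
  by move=> _ <-; congr (ln _%:R); apply: eq_bigl.
apply: (big_ind2 (fun (u : nat) (v : R) => (0 < u)%N /\ ln u%:R = v)).
- by rewrite ln1.
- move=> u v u' v' [u0 <-] [u0' <-]; rewrite muln_gt0 u0 u0'; split => //.
  by rewrite natrM lnM// posrE ltr0n.
move=> p _; have [->|p0] := posnP p; first by rewrite (_ : logn 0 n = 0%N) ?expn0 ?ln1 ?mul0r// lognE.
by rewrite expn_gt0 p0 natrX lnXn ?ltr0n// mulr_natl.
Qed.

(** No q i divides a q j - 1: the quotient cannot be 1, both primes being odd, nor at least 2, since
    q j < 2X. The valuation at q i thus reads off M i, and independence of the q - 1 gives the
    rest. *)
Lemma shifted_primes_indep (k X : nat) (q : 'I_k -> nat) (M M' N N' : 'I_k -> nat) :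
  (2 < X)%N -> injective q -> (forall i, prime (q i)) -> (forall i, X <= q i < 2 * X)%N ->
  mult_indep (fun i => (q i).-1) ->
  (\prod_i q i ^ M i * \prod_i (q i).-1 ^ N i =
   \prod_i q i ^ M' i * \prod_i (q i).-1 ^ N' i)%N ->
  (forall i, M i = M' i) /\ (forall i, N i = N' i).
Proof.
move=> X2 q_inj qp qX ind E.
have q0 i : (0 < q i)%N by exact: prime_gt0.
have q10 i : (0 < (q i).-1)%N by have := prime_gt1 (qp i); lia.
have lognE p A B : logn p (\prod_i q i ^ A i * \prod_i (q i).-1 ^ B i) =
    (\sum_i A i * logn p (q i) + \sum_i B i * logn p (q i).-1)%N.
  rewrite lognM ?logn_prod_exp// prodn_gt0// => i; by rewrite expn_gt0 ?q0 ?q10.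
have nd i j : logn (q i) (q j).-1 = 0%N.
  apply/eqP; rewrite -leqn0 leqNgt logn_gt0 mem_primes; apply/negP => /and3P[_ _ ij].
  have [m mE] := dvdnP ij.
  have oddq l : odd (q l).
    by have := even_prime (qp l) => -[ql|//]; have := qX l; lia.
  have := qX i; have := qX j; have := q10 j; rewrite mE.
  case: m mE => [|[|m]] mE; [by []| | by lia].
  by rewrite mul1n in mE; have := oddq j; have := oddq i; rewrite -mE;
     have := prime_gt0 (qp j); case: (q j) => //= n _ ->.
have MM i : M i = M' i.
  have sum1 A : (\sum_j A j * logn (q i) (q j) = A i)%N.
    rewrite (bigD1 i)//= big1 ?addn0 => [|j ji].
      by rewrite logn_prime// eqxx muln1.
    by rewrite logn_prime// (inj_eq q_inj) eq_sym (negbTE ji) muln0.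
  have sum2 B : (\sum_j B j * logn (q i) (q j).-1 = 0)%N.
    by rewrite big1// => j _; rewrite nd muln0.
  by have := congr1 (logn (q i)) E; rewrite !lognE !sum1 !sum2 !addn0.
split => // i; suff : (N i)%:Z - (N' i)%:Z = 0 by lia.
apply: (ind (fun i => (N i)%:Z - (N' i)%:Z)) => p.
have := congr1 (logn p) E; rewrite !lognE.
rewrite [in X in X = _ -> _](eq_bigr (fun i => M' i * logn p (q i))%N) => [|j _]; last by rewrite MM.
move=> /addnI e; under eq_bigr do rewrite mulrBl -!PoszM.
by rewrite sumrB -!(rmorph_sum Posz)/= e subrr.
Qed.

(** There are k + 1 valuation vectors supported on at most k primes. The size P = (2 (k+1) A)^k
    satisfies Siegel's condition because (2 (k+1) A (P+1))^k = P (P+1)^k < (P+1)^(k+1). *)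
Lemma exists_relation (k A : nat) (Q : 'I_k.+1 -> nat) (S : seq nat) :
  (0 < A)%N -> (size S <= k)%N -> (forall i p, logn p (Q i) <= A)%N ->
  (forall i p, p \in primes (Q i) -> p \in S) ->
  exists b : 'I_k.+1 -> int, [/\ exists i, b i != 0,
    forall i, `|b i| <= ((2 * (k.+1 * A)) ^ k)%N%:Z &
    forall p, \sum_i b i * (logn p (Q i))%:Z = 0].
Proof.
move=> A0 Sk QA QS; set P := ((2 * (k.+1 * A)) ^ k)%N.
have [||b [b0 bP bE]] := @siegel 'I_k.+1 'I_(size S)
    (fun j i => (logn (nth 0%N S j) (Q i))%:Z) A P.
- by move=> j i; have := QA i (nth 0%N S j); lia.
- rewrite !card_ord expnS.
  apply: (@leq_ltn_trans ((2 * (k.+1 * A) * P.+1) ^ k)).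
    apply: (@leq_trans ((2 * (k.+1 * A) * P.+1) ^ size S)).
      by apply: leq_expn2r; nia.
    by rewrite leq_pexp2l// !muln_gt0 A0.
  by rewrite expnMn -/P ltn_mul2r expn_gt0 leqnn.
exists b; split => // p.
have [pS|pS] := boolP (p \in S).
  have pi : (index p S < size S)%N by rewrite index_mem.
  have := bE (Ordinal pi); rewrite /= nth_index// => E.
  by rewrite -[RHS]E; apply: eq_bigr => i _; rewrite mulrC.
rewrite big1// => i _; suff -> : logn p (Q i) = 0%N by rewrite mulr0.
apply/eqP; rewrite -leqn0 leqNgt logn_gt0; apply: contra pS; exact: QS.
Qed.

Lemma ln_pow_sub1_bound (R : realType) (q r : nat) : (1 < q)%N -> (0 < r)%N ->
  `|r%:R * ln (q%:R : R) - ln ((q ^ r).-1)%:R| <= 2 / 2 ^+ r.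
Proof.
move=> q1 r0; have q0 : (0 < q)%N by exact: ltnW.
have qr1 : (1 < q ^ r)%N by rewrite -(exp1n r) ltn_exp2r.
have m0 : (0 < (q ^ r).-1)%N by lia.
have -> : r%:R * ln (q%:R : R) = ln (q ^ r)%:R.
  by rewrite natrX lnXn ?ltr0n// mulr_natl.
have mR : 0 < ((q ^ r).-1)%:R :> R by rewrite ltr0n.
have qE : (q ^ r)%:R = (q ^ r).-1%:R + 1 :> R by rewrite natr1 prednK// ltnW.
rewrite -ln_div ?posrE ?ltr0n// ?(ltnW qr1)// qE.
have -> : ((q ^ r).-1%:R + 1) / (q ^ r).-1%:R = 1 + ((q ^ r).-1%:R)^-1 :> R.
  by rewrite mulrDl mulfV ?gt_eqF// mul1r.
have i0 : 0 < ((q ^ r).-1%:R)^-1 :> R by rewrite invr_gt0.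
rewrite ger0_norm; last by rewrite ln_ge0// lerDl ltW.
apply: (le_trans (le_ln1Dx _)); first by lra.
rewrite ler_pdivlMr ?exprn_gt0// ler_pdivrMl// -natrX mulrC -natrM ler_nat.
have : (2 ^ r <= q ^ r)%N by apply: leq_expn2r.
lia.
Qed.

(** As (q - 1) Q = q^r - 1 for the repunit Q, ln Q is r ln q - ln (q - 1) up to 2/2^r, and the
    b-combination of the ln Q is 0. *)
Lemma relation_form_small (R : realType) (k P m : nat) (q r : 'I_k -> nat) (b : 'I_k -> int) :
  (forall i, 1 < q i)%N -> (forall i, 0 < r i)%N -> (forall i, m <= r i)%N ->
  (forall i, `|b i| <= P%:Z) ->
  (forall p, \sum_i b i * (logn p (repunit (r i) (q i)))%:Z = 0) ->
  `|\sum_i (b i)%:~R * ((r i)%:R * ln (q i)%:R - ln (q i).-1%:R)| <=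
    (k * (P * 2))%:R / 2 ^+ m :> R.
Proof.
move=> q1 r0 mr bP bE.
have Q0 i : (0 < repunit (r i) (q i))%N.
  have := repunitE (r i) (ltnW (q1 i)); case: (repunit _ _) => //.
  by rewrite muln0 => e; have := q1 i; have := ltn_exp2l 0 (r i) (q1 i); rewrite -e r0; lia.
pose B := (\sum_i repunit (r i) (q i))%N.
have lnQ i : ln ((repunit (r i) (q i))%:R : R) =
    \sum_(p < B.+1) (logn p (repunit (r i) (q i)))%:R * ln p%:R.
  by apply: ln_nat_logn; rewrite Q0 /B (bigD1 i)//= leq_addr.
have E0 : \sum_i (b i)%:~R * ln ((repunit (r i) (q i))%:R : R) = 0.
  under eq_bigr do rewrite lnQ mulr_sumr.
  rewrite exchange_big/= big1// => p _.
  have := congr1 (fun u : int => u%:~R : R) (bE p); rewrite /= rmorph_sum/= => E.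
  under eq_bigr do rewrite mulrA.
  rewrite -mulr_suml (_ : \sum_i _ = 0) ?mul0r// -[RHS]E.
  by apply: eq_bigr => i _; rewrite intrM.
have -> : \sum_i (b i)%:~R * ((r i)%:R * ln (q i)%:R - ln (q i).-1%:R) =
    \sum_i (b i)%:~R * ((r i)%:R * ln (q i)%:R - ln ((q i) ^ (r i)).-1%:R) :> R.
  apply: (@etrans _ _ (\sum_i (b i)%:~R * ((r i)%:R * ln (q i)%:R - ln ((q i) ^ (r i)).-1%:R)
     + \sum_i (b i)%:~R * ln ((repunit (r i) (q i))%:R : R))); last by rewrite E0 addr0.
  rewrite -big_split/=; apply: eq_bigr => i _; rewrite -mulrDr.
  congr (_ * _); rewrite -(repunitE _ (ltnW (q1 i))) succnK natrM lnM ?posrE ?ltr0n//.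
    by ring.
  by have := q1 i; lia.
apply: (le_trans (ler_norm_sum _ _ _)).
rewrite natrM -mulrA -[k in leRHS]card_ord mulr_natl -sumr_const; apply: ler_sum => i _.
rewrite normrM natrM -mulrA ler_pM//.
  by rewrite -intr_norm -[P%:R]/(P%:Z%:~R) ler_int.
apply: (le_trans (ln_pow_sub1_bound R (q1 i) (r0 i))).
rewrite ler_pM2l// lef_pV2 ?posrE ?exprn_gt0// ler_eXn2l ?ltr1n//.
Qed.

Lemma repunit_lt r q y : (1 < q < 2 ^ y)%N -> (0 < r)%N -> (0 < repunit r q < 2 ^ (y * r))%N.
Proof.
case/andP => q1 qy r0; have := repunitE r (ltnW q1).
have qr1 : (1 < q ^ r)%N by rewrite -(exp1n r) ltn_exp2r.
have qr : (q ^ r < 2 ^ (y * r))%N by rewrite expnM ltn_exp2r.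
case: (repunit r q) => [|u] E; first by rewrite muln0 in E; lia.
apply: leq_ltn_trans qr; rewrite -E; apply: leqW; rewrite leq_pmull//; lia.
Qed.

(** An index i0 with b i0 <> 0 supplies the distinguished logarithm, since [baker] wants a nonzero
    leading coefficient; the other 2k + 1 logarithms give d. The valuations of the repunits are
    below (i+1) r, whence A = 2^(rho + i + 1), and 2^beta bounds both b and b r. *)
Lemma exponent_bound (R : realType) (k i rho m e : nat) (q r : 'I_k.+1 -> nat) (S : seq nat) :
  let n := (k + k.+1).+1 in
  let beta := (k.+1 * (k.+1 + rho + i.+1))%N in
  (1 < i)%N -> injective q -> (forall j, prime (q j)) ->
  (forall j, 2 ^ i <= q j < 2 ^ i.+1)%N ->
  (forall j, 0 < r j < 2 ^ rho)%N -> (forall j, m <= r j)%N ->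
  (size S <= k)%N -> (forall j p, p \in primes (repunit (r j) (q j)) -> p \in S) ->
  mult_indep (fun j => (q j).-1) ->
  (2 ^ ((2 * n ^ 2).-1 + 8) * (n * (beta + i.+1 + e * (2 * (k + k.+1) + 1) + 4)) <= 2 ^ e)%N ->
  (m < k.+1 + beta + 2 ^ (e * (2 * n ^ 2 + 2 * n + 2)))%N.
Proof.
move=> n beta i1 q_inj qp qB rB mr Sk QS ind eB.
have q1 j : (1 < q j)%N by exact: prime_gt1.
have r0 j : (0 < r j)%N by have /andP[] := rB j.
have qy j : (q j < 2 ^ i.+1)%N by have /andP[] := qB j.
set A := (2 ^ (rho + i.+1))%N.
have QA j p : (logn p (repunit (r j) (q j)) <= A)%N.
  apply/ltnW/(@leq_trans (i.+1 * r j)).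
    by apply: logn_lt_exp2; apply: repunit_lt; rewrite ?q1 ?qy.
  rewrite /A expnD mulnC leq_mul//; first by have /andP[_ /ltnW] := rB j.
  exact/ltnW/ltn_expl.
have A0 : (0 < A)%N by rewrite expn_gt0.
have [b [[i0 b0] bP bE]] := exists_relation A0 Sk QA QS.
set P := ((2 * (k.+1 * A)) ^ k)%N in bP.
have PB : (P * 2 ^ rho <= 2 ^ beta)%N.
  have : (P <= (2 * (2 ^ k * A)) ^ k)%N.
    by apply: leq_expn2r; rewrite leq_mul2l leq_mul2r (ltn_expl k (isT : 1 < 2)%N) !orbT.
  rewrite /A -!expnD -expnS -expnM => PP.
  apply: (@leq_trans (2 ^ ((k + (rho + i.+1)).+1 * k) * 2 ^ rho)).
    by rewrite leq_mul2r PP orbT.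
  rewrite -expnD leq_exp2l// /beta; clear; nia.
have P0 : (P <= 2 ^ beta)%N by apply: leq_trans PB; rewrite leq_pmulr// expn_gt0.
have small := relation_form_small R q1 r0 mr bP bE.
(* The first k places hold the q other than q i0, the last k + 1 all the q - 1. *)
pose a (j : 'I_(k + k.+1)) : nat :=
  match fintype.split j with inl u => q (lift i0 u) | inr u => (q u).-1 end.
pose c (j : 'I_(k + k.+1)) : int :=
  match fintype.split j with inl u => b (lift i0 u) * (r (lift i0 u))%:Z | inr u => - b u end.
have al u : a (lshift _ u) = q (lift i0 u).
  by rewrite /a -[lshift _ u]/(unsplit (inl u)) unsplitK.
have ar u : a (rshift _ u) = (q u).-1.
  by rewrite /a -[rshift _ u]/(unsplit (inr u)) unsplitK.
have cl u : c (lshift _ u) = b (lift i0 u) * (r (lift i0 u))%:Z.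
  by rewrite /c -[lshift _ u]/(unsplit (inl u)) unsplitK.
have cr u : c (rshift _ u) = - b u.
  by rewrite /c -[rshift _ u]/(unsplit (inr u)) unsplitK.
have brB j : `|b j * (r j)%:Z| <= (2 ^ beta)%N%:Z.
  apply: (@le_trans _ _ (P * 2 ^ rho)%N%:Z); last by rewrite lez_nat.
  rewrite normrM PoszM ler_pM//; have /andP[_ /ltnW] := rB j; lia.
have aB u : (0 < q u <= 2 ^ i.+1)%N by rewrite ltnW//= ltnW.
have aB' u : (0 < (q u).-1 <= 2 ^ i.+1)%N.
  by have := q1 u; have := qy u; lia.
have LE : linform R (q i0) a (b i0 * (r i0)%:Z) c =
    \sum_j (b j)%:~R * ((r j)%:R * ln (q j)%:R - ln (q j).-1%:R).
  rewrite /linform big_split_ord/=.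
  under eq_bigr do rewrite al cl intrM -pmulrn.
  under [X in _ + (_ + X)]eq_bigr do rewrite ar cr intrN.
  under [RHS]eq_bigr do rewrite mulrBr.
  rewrite sumrB [X in _ = X - _](bigD1_ord i0)//= -[RHS]addrA; congr (_ + (_ + _)).
  - by rewrite intrM -pmulrn mulrA.
  - by apply: eq_bigr => u _; rewrite mulrA.
  - by rewrite -sumrN; apply: eq_bigr => u _; rewrite mulNr.
have X2 : (2 < 2 ^ i)%N by rewrite -[2%N]/(2 ^ 1)%N ltn_exp2l.
have qX j : (2 ^ i <= q j < 2 * 2 ^ i)%N by rewrite -expnS.
have indep m0 m0' (m1 m1' : 'I_(k + k.+1) -> nat) :
    (q i0 ^ m0 * \prod_j a j ^ m1 j = q i0 ^ m0' * \prod_j a j ^ m1' j)%N ->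
    m0 = m0' /\ forall j, m1 j = m1' j.
  pose M m0 (m1 : 'I_(k + k.+1) -> nat) j :=
    if unlift i0 j is Some u then m1 (lshift _ u) else m0.
  pose N (m1 : 'I_(k + k.+1) -> nat) j := m1 (rshift _ j).
  have prodE m0'' m1'' : (q i0 ^ m0'' * \prod_j a j ^ m1'' j =
     \prod_j q j ^ M m0'' m1'' j * \prod_j (q j).-1 ^ N m1'' j)%N.
    rewrite big_split_ord/= [in RHS](bigD1_ord i0)//= mulnA; congr (_ * _ * _)%N.
    - by rewrite /M unlift_none.
    - by apply: eq_bigr => u _; rewrite al /M liftK.
    - by apply: eq_bigr => u _; rewrite ar.
  rewrite !prodE => /(shifted_primes_indep X2 q_inj qp qX ind)[MM NN].
  split; first by have := MM i0; rewrite /M unlift_none.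
  move=> j; have [u ->|u ->] := split_ordP j; last exact: NN.
  by have := MM (lift i0 u); rewrite /M liftK.
have b0r : b i0 * (r i0)%:Z != 0 by rewrite mulf_neq0//; have := r0 i0; lia.
have cB j : `|c j| <= (2 ^ beta)%N%:Z.
  have [u ->|u ->] := split_ordP j; first by rewrite cl.
  by rewrite cr normrN (le_trans (bP u))// lez_nat.
have aBB j : (0 < a j <= 2 ^ i.+1)%N.
  by have [u ->|u ->] := split_ordP j; rewrite ?al ?ar.
have := baker R (isT : (0 < i.+1)%N) b0r (brB i0) cB (aB i0) aBB indep eB.
rewrite LE => /lt_le_trans/(_ small).
rewrite -/n ltr_pdivlMr ?exprn_gt0// mulrC ltr_pdivrMr ?exprn_gt0//.
rewrite -!natrX -natrM ltr_nat => h.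
rewrite -(@ltn_exp2l 2)//; apply: (leq_trans h).
rewrite !expnD leq_mul2r; apply/orP; right.
apply: (@leq_trans (k.+1 * 2 * 2 ^ beta)).
  by rewrite -mulnA leq_mul2l (mulnC P) leq_mul2l P0 orbT.
have k2 : (k.+1 * 2 <= 2 ^ k.+1)%N.
  by rewrite expnS mulnC leq_mul2l; exact: ltn_expl.
by rewrite leq_mul2r k2 orbT.
Qed.

Local Close Scope ring_scope.

(** * Counting primes in dyadic blocks *)

From mathcomp Require Import Rstruct.

(** The parameter e must satisfy an inequality with e on both sides, linearly on the left and as 2^e
    on the right. With G < 2^g and e = 2g, one factor 2^g pays for G and the other for g. Since n =
    2K, the final exponent 2 (2n^2 + 2n + 2) + 1 = 16K^2 + 8K + 5 is at most 29K^2; similarly 2G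
    carries a power of 2 with exponent 8K^2 + 3K + 14 <= 25K^2. *)
Lemma exponent_bound_poly (k i rho m : nat) (q r : 'I_k.+1 -> nat) (S : seq nat) :
  1 < i -> injective q -> (forall j, prime (q j)) ->
  (forall j, 2 ^ i <= q j < 2 ^ i.+1) ->
  (forall j, 0 < r j < 2 ^ rho) -> (forall j, m <= r j) ->
  size S <= k -> (forall j p, p \in primes (repunit (r j) (q j)) -> p \in S) ->
  mult_indep (fun j => (q j).-1) ->
  m < (2 ^ (25 * k.+1 ^ 2) * (rho + i.+1)) ^ (29 * k.+1 ^ 2).
Proof.
move=> i1 q_inj qp qB rB mr Sk QS ind.
set K := k.+1; pose n := (k + k.+1).+1; pose y := i.+1.
pose beta := K * (K + rho + y).
pose G := 2 ^ ((2 * n ^ 2).-1 + 9) * (n * (beta + y + 2 * (k + k.+1) + 5)).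
pose g := (trunc_log 2 G).+1.
have G0 : 0 < G by rewrite !muln_gt0 expn_gt0/= addn_gt0 orbT.
have Gg : G < 2 ^ g by exact: trunc_log_ltn.
have gG : 2 ^ g <= 2 * G by rewrite expnS leq_mul2l trunc_logP.
have nE : n = 2 * K by rewrite /n /K; lia.
have eB : 2 ^ ((2 * n ^ 2).-1 + 8) * (n * (beta + y + 2 * g * (2 * (k + k.+1) + 1) + 4)) <= 2 ^ (2 * g).
  rewrite [leqRHS](_ : _ = 2 ^ g * 2 ^ g); last by rewrite mul2n -addnn expnD.
  apply: (@leq_trans (G * g)); last by apply: leq_mul; apply: ltnW => //; exact: ltn_expl.
  rewrite /G -[9]/(8 + 1) addnA (expnD _ (_ + 8)) expn1 -!mulnA leq_mul2l; apply/orP; right.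
  rewrite [leqRHS]mulnCA leq_mul2l; apply/orP; right.
  have : 0 < g by []. move: (beta) (y) (k) (g) => B Y k' g'. clear. nia.
have := @exponent_bound Rdefinitions.R k i rho m (2 * g) q r S i1 q_inj qp qB rB mr Sk QS ind.
move=> /(_ eB) h; apply: (leq_trans h).
have GB : 2 * G <= 2 ^ (25 * K ^ 2) * (rho + y).
  have E1 : beta + y + 2 * (k + k.+1) + 5 <= 10 * K ^ 2 * (rho + y).
    rewrite /beta /y /K; clear; nia.
  have E2 : 2 * (2 ^ ((2 * n ^ 2).-1 + 9) * (n * (10 * K ^ 2))) <= 2 ^ (25 * K ^ 2).
    have K3 : K ^ 3 <= 2 ^ (3 * K) by rewrite mulnC expnM leq_exp2r// ltnW// ltn_expl.
    apply: (@leq_trans (2 * (2 ^ ((2 * n ^ 2).-1 + 9) * (2 ^ 5 * 2 ^ (3 * K))))).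
      rewrite !leq_mul2l /= expn_eq0/= nE; apply: (@leq_trans (20 * K ^ 3)).
        by rewrite (expnS _ 2); lia.
      by rewrite leq_mul.
    rewrite -!expnD -expnS leq_exp2l// nE /K; clear; nia.
  apply: leq_trans (leq_mul E2 (leqnn (rho + y))); rewrite /G.
  apply: (@leq_trans (2 * (2 ^ ((2 * n ^ 2).-1 + 9) * (n * (10 * K ^ 2 * (rho + y)))))).
    by do 3 (rewrite leq_mul2l; apply/orP; right).
  by rewrite -!mulnA.
apply: (@leq_trans ((2 * G) ^ (29 * K ^ 2))); last exact: leq_expn2r.
pose kap := 2 * n ^ 2 + 2 * n + 2.
have kapB : (2 * kap).+1 <= 29 * K ^ 2 by rewrite /kap nE /K; clear; nia.
apply: (@leq_trans ((2 * G) ^ (2 * kap).+1)); last by rewrite leq_pexp2l// muln_gt0.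
have Z : 2 ^ (2 * g * kap) <= (2 * G) ^ (2 * kap).
  by rewrite (_ : 2 * g * kap = g * (2 * kap)) ?expnM ?leq_expn2r//; lia.
have KB : K + beta <= 2 * G.
  have h1 : K + beta <= beta + y + 2 * (k + k.+1) + 5.
    by rewrite /K; move: (beta) (y); clear; lia.
  apply: (leq_trans h1); rewrite /G; set X := _ + 5.
  by rewrite !mulnA leq_pmull// !muln_gt0 expn_gt0.
have G1 : 2 * G <= (2 * G) ^ (2 * kap).
  have kap0 : 0 < 2 * kap by rewrite muln_gt0 /kap addn2.
  rewrite -[leqLHS]expn1; apply: leq_pexp2l => //; by rewrite muln_gt0 G0.
apply: (leq_trans (leq_add KB Z)); rewrite expnS.
by move: G1 G0; move: (_ ^ (2 * kap)) => Y; clear; nia.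
Qed.

(** More than (i+1)^k elements would include k + 1 with multiplicatively independent q - 1, and the
    lower bound m for the r would contradict Baker's bound, into which the largest r enters only
    through its bit length rho. *)
Lemma block_half_size (k i rho m : nat) (t : seq nat) (r : nat -> nat) (S : seq nat) :
  1 < i -> uniq t -> (forall q, q \in t -> prime q && (2 ^ i <= q < 2 ^ i.+1)) ->
  0 < m -> (forall q, q \in t -> m <= r q < 2 ^ rho) ->
  size S <= k -> (forall q p, q \in t -> p \in primes (repunit (r q) q) -> p \in S) ->
  (2 ^ (25 * k.+1 ^ 2) * (rho + i.+1)) ^ (29 * k.+1 ^ 2) <= m ->
  size t <= i.+1 ^ k.
Proof.
move=> i1 ut tP m0 rB Sk QS mB; rewrite leqNgt; apply/negP => tk.
pose z (j : 'I_(size t)) := (nth 0 t j).-1.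
have tin (j : 'I_(size t)) : nth 0 t j \in t by exact: mem_nth.
have tq j : 1 < nth 0 t (j : 'I_(size t)) by have /andP[/prime_gt1] := tP _ (tin j).
have nth_inj (j j' : 'I_(size t)) : nth 0 t j = nth 0 t j' -> j = j'.
  by move/eqP; rewrite nth_uniq// => /eqP/val_inj.
have [||f f_inj find] := @mult_indep_select k (size t) i.+1 z _ _ tk.
- move=> j j' e; apply: nth_inj; move: e (tq j) (tq j'); rewrite /z; lia.
- by move=> j; have /andP[_ /andP[_ h]] := tP _ (tin j); have := tq j; rewrite /z; lia.
suff : m < (2 ^ (25 * k.+1 ^ 2) * (rho + i.+1)) ^ (29 * k.+1 ^ 2) by rewrite ltnNge mB.
apply: (@exponent_bound_poly k i rho m (fun j => nth 0 t (f j)) (fun j => r (nth 0 t (f j))) S i1) => //.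
- by move=> j j' /nth_inj/f_inj.
- by move=> j; have /andP[] := tP _ (tin (f j)).
- by move=> j; have /andP[] := tP _ (tin (f j)).
- by move=> j; have /andP[h ->] := rB _ (tin (f j)); rewrite andbT (leq_trans m0).
- by move=> j; have /andP[] := rB _ (tin (f j)).
- by move=> j p; apply: QS.
Qed.

Section BlockCount.
Variables (k i : nat).
Hypothesis i1 : 1 < i.
Let K := k.+1.
Let y := i.+1.
Let c := 58 * K ^ 2.
(* The exponent is twice that of [exponent_bound_poly], which leaves room for
   the logarithm of the largest r in [threshold_split]. *)
Definition exp_threshold := (2 ^ (2 * (58 * k.+1 ^ 2)) * i.+1) ^ (58 * k.+1 ^ 2).
Let Rb := exp_threshold.

(** Here rho stands for the least r of a class, and 2^(y rho) bounds the greatest. The cut at 2^rho0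
    >= (y rho)^c gives both halves the condition of [block_half_size]: below it with m = rho and bit
    length rho0, above it with m = 2^rho0 and bit length y rho. *)
Lemma threshold_split rho : Rb <= rho ->
  let rho0 := c * (trunc_log 2 (y * rho)).+1 in
  (2 ^ (25 * K ^ 2) * (rho0 + y)) ^ (29 * K ^ 2) <= rho /\
  (2 ^ (25 * K ^ 2) * (y * rho + y)) ^ (29 * K ^ 2) <= 2 ^ rho0.
Proof.
move=> Rrho rho0; set mu := 29 * K ^ 2; set c1 := 2 ^ (25 * K ^ 2).
have cmu : c = 2 * mu by rewrite /c /mu mulnA.
have K0 : 0 < K ^ 2 by rewrite expn_gt0.
have c0 : 0 < c by rewrite muln_gt0.
have c1c : 2 * c1 <= 2 ^ (2 * c).
  by rewrite /c1 -expnS leq_exp2l// /c; move: K0; move: (K ^ 2); clear; lia.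
have V0 : 0 < 2 ^ (2 * c) * y by rewrite muln_gt0 expn_gt0.
have RbE : Rb = (2 ^ (2 * c) * y) ^ c by [].
have V_Rb : 2 ^ (2 * c) * y <= Rb.
  by rewrite RbE -[leqLHS]expn1 leq_pexp2l.
have yrho : y <= rho.
  by apply: leq_trans Rrho; apply: leq_trans V_Rb; rewrite leq_pmull// expn_gt0.
have c1rho : 2 * c1 <= rho.
  apply: leq_trans Rrho; apply: leq_trans V_Rb; apply: (leq_trans c1c).
  by rewrite leq_pmulr.
have y0 : 0 < y by [].
have rho_gt0 : 0 < rho by exact: leq_trans yrho.
have L : y * rho < 2 ^ (trunc_log 2 (y * rho)).+1 by exact: trunc_log_ltn.
split; last first.
  apply: (@leq_trans ((y * rho) ^ c)).
    rewrite cmu expnM; apply: leq_expn2r; rewrite -mulnn.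
    apply: (@leq_trans ((2 * c1) * (y * rho))).
      by rewrite -mulnA mulnCA leq_mul2l mul2n -addnn leq_add2l leq_pmulr ?orbT.
    by rewrite leq_mul2r (leq_trans c1rho) ?orbT// leq_pmull.
  by rewrite /rho0 (mulnC c) expnM leq_expn2r// ltnW.
have [yr|ry] := leqP rho0 y.
  apply: (@leq_trans ((2 ^ (2 * c) * y) ^ mu)).
    apply: leq_expn2r; apply: leq_trans (leq_mul c1c (leqnn y)).
    by rewrite -mulnA mulnCA leq_mul2l mul2n -addnn leq_add2r yr orbT.
  apply: leq_trans Rrho; rewrite RbE leq_pexp2l// cmu; lia.
apply: (@leq_trans ((2 * c1 * rho0) ^ mu)).
  apply: leq_expn2r; rewrite -mulnA mulnCA leq_mul2l mul2n -addnn leq_add2l (ltnW ry) orbT //.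
(* A logarithm against a power: c u is log2 rho rounded down to a multiple of c, rho0 is at most 2
   c^2 (u + 1), and 2^(2u) beats this times 2 c1 because u >= 2c. *)
pose m' := trunc_log 2 rho; pose u := m' %/ c.
have m'B : 2 ^ m' <= rho by exact: trunc_logP.
apply: leq_trans m'B.
apply: (@leq_trans (2 ^ (c * u))); last by rewrite leq_exp2l// mulnC leq_trunc_div.
rewrite (_ : c * u = 2 * u * mu); last by rewrite cmu; lia.
rewrite expnM; apply: leq_expn2r.
have u2c : 2 * c <= u.
  rewrite leq_divRL// /m'; apply: trunc_log_max => //.
  by apply: leq_trans Rrho; rewrite RbE expnMn -expnM leq_pmulr// expn_gt0.
have rho0B : rho0 <= c * (2 * (m' + 1)).
  rewrite leq_mul2l; apply/orP; right; rewrite mulnDr muln1 addn2 ltnS.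
  have rB : rho < 2 ^ m'.+1 by exact: trunc_log_ltn.
  rewrite -ltnS -(@ltn_exp2l 2)//.
  apply: (@leq_ltn_trans (y * rho)); first by rewrite trunc_logP// muln_gt0 y0.
  have -> : (2 * m').+2 = m'.+1 + m'.+1 by lia.
  by rewrite expnD ltn_mul// (leq_ltn_trans yrho).
have m'u : m' + 1 <= c * u.+1 by rewrite addn1 mulnC ltn_ceil.
have c2 : c ^ 2 <= 2 ^ c.
  have mu0 : 0 < mu by rewrite muln_gt0.
  have : 2 * mu <= 2 ^ mu.
    by rewrite -(prednK mu0) (expnS 2) leq_mul2l ltn_expl.
  by move=> h; rewrite cmu (mulnC 2 mu) expnM leq_expn2r// mulnC.
apply: (@leq_trans (2 * c1 * (2 * c ^ 2 * u.+1))).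
  rewrite leq_mul2l; apply/orP; right; apply: (leq_trans rho0B).
  apply: (@leq_trans (c * (2 * (c * u.+1)))).
    by do 2 (rewrite leq_mul2l; apply/orP; right).
  by rewrite -mulnn; move: (c) (u); clear; nia.
rewrite [leqRHS](_ : _ = 2 ^ u * 2 ^ u); last by rewrite mul2n -addnn expnD.
rewrite mulnA; apply: leq_mul; last exact: ltn_expl.
apply: (@leq_trans (2 ^ (2 * c))); last by rewrite leq_exp2l.
have -> : 2 * c1 * (2 * c ^ 2) = (2 ^ 2 * c1) * c ^ 2 by lia.
rewrite [leqRHS](_ : _ = 2 ^ c * 2 ^ c); last by rewrite mul2n -addnn expnD.
apply: leq_mul => //.
by rewrite /c1 -expnD leq_exp2l// /c; move: K0; move: (K ^ 2); clear; lia.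
Qed.

Lemma block_class_size p (t : seq nat) (r : nat -> nat) (S : seq nat) :
  uniq t -> (forall q, q \in t -> prime q && (2 ^ i <= q < 2 ^ i.+1)) ->
  prime p -> (forall q, q \in t -> prime (r q) && (p %| repunit (r q) q)) ->
  (forall q, q \in t -> Rb <= r q) ->
  size S <= k -> (forall q p, q \in t -> p \in primes (repunit (r q) q) -> p \in S) ->
  size t <= 2 * y ^ k.
Proof.
move=> ut tP pp rp rB Sk QS.
case: t ut tP rp rB QS => // q0 t0; set t := q0 :: t0 => ut tP rp rB QS.
have [qm qmt qmin] : exists2 q, q \in t & forall q', q' \in t -> r q <= r q'.
  have [j _ jmin] := @arg_minnP _ (ord0 : 'I_(size t0).+1) xpredT (fun j => r (nth 0 t j)) isT.
  exists (nth 0 t j); first exact: mem_nth.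
  move=> q' q't; have ix : index q' t < (size t0).+1 by rewrite -index_mem in q't.
  by have := jmin (Ordinal ix) isT; rewrite /= nth_index.
set rho := r qm in qmin.
have rp' q : q \in t -> r q < 2 ^ (y * rho).
  move=> qt; have /andP[rq pq] := rp q qt; have /andP[rm pm] := rp qm qmt.
  have /andP[pq' _] := tP q qt; have /andP[pqm /andP[_ qmB]] := tP qm qmt.
  have := prime_dvd_repunit_ge pp rq (prime_gt0 pq') pq => /leq_ltn_trans; apply.
  have := @repunit_lt (r qm) qm y; rewrite prime_gt1// => /(_ qmB (prime_gt0 rm))/andP[h0 h].
  by apply: leq_ltn_trans h; rewrite dvdn_leq.
have [] := threshold_split (rB qm qmt).
set rho0 := _ * _.+1 => h1 h2.
have rho_gt0 : 0 < rho by have /andP[/prime_gt0] := rp qm qmt.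
rewrite -(count_predC (fun q => r q < 2 ^ rho0) t) -!size_filter mul2n -addnn.
apply: leq_add.
  apply: (@block_half_size k i rho0 rho _ r S i1); rewrite ?filter_uniq//.
  - by move=> q; rewrite mem_filter => /andP[_ /tP].
  - by move=> q; rewrite mem_filter => /andP[-> qt]; rewrite qmin.
  - by move=> q p'; rewrite mem_filter => /andP[_ qt]; exact: QS.
apply: (@block_half_size k i (y * rho) (2 ^ rho0) _ r S i1); rewrite ?filter_uniq ?expn_gt0//.
- by move=> q; rewrite mem_filter => /andP[_ /tP].
- by move=> q; rewrite mem_filter /= -leqNgt => /andP[-> qt]; rewrite rp'.
- by move=> q p'; rewrite mem_filter => /andP[_ qt]; exact: QS.
Qed.

End BlockCount.

Lemma repunit_inj r : 1 < r -> injective (repunit r).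
Proof.
move=> r1.
have mono q q' : q < q' -> repunit r q < repunit r q'.
  move=> qq; rewrite /repunit (bigD1 (Ordinal r1))//= [ltnRHS](bigD1 (Ordinal r1))//=.
  rewrite !expn1 -addSn leq_add// leq_sum// => j _; exact/leq_expn2r/ltnW.
move=> q q' e; have [/mono|/mono|//] := ltngtP q q'; by rewrite e ltnn.
Qed.

Lemma block_small_size (k i B : nat) (s : seq nat) (r : nat -> nat) (S : seq nat) :
  uniq s -> (forall q, q \in s -> prime q && (q < 2 ^ i.+1)) ->
  (forall q, q \in s -> 1 < r q < B) ->
  size S <= k -> (forall q p, q \in s -> p \in primes (repunit (r q) q) -> p \in S) ->
  size s <= B * (i.+1 * B) ^ k.
Proof.
move=> us sP rB Sk QS.
case: s us sP rB QS => // q0 s0; set s := q0 :: s0 => us sP rB QS.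
have B0 : 0 < B by have := rB q0 (mem_head _ _); lia.
have yB0 : 0 < i.+1 * B by rewrite muln_gt0.
pose Q q := repunit (r q) q.
have QB q : q \in s -> 0 < Q q < 2 ^ (i.+1 * B).
  move=> qs; have /andP[/prime_gt1 q1 qy] := sP q qs; have /andP[r1 rq] := rB q qs.
  have := @repunit_lt (r q) q i.+1; rewrite q1 qy => /(_ isT (ltnW r1))/andP[-> h]/=.
  by apply: (leq_trans h); rewrite leq_exp2l// leq_mul2l ltnW.
pose F q : 'I_B.-1.+1 * {ffun 'I_k -> 'I_(i.+1 * B).-1.+1} :=
  (inord (r q), [ffun j : 'I_k => inord (logn (nth 0 S j) (Q q))]).
have F_inj : {in s &, injective F}.
  move=> q q' qs q's [/(congr1 val) /= + /ffunP FE].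
  have /andP[r1 rq] := rB q qs; have /andP[_ rq'] := rB q' q's.
  rewrite !inordK ?prednK// => rr.
  have /andP[Q0 Qy] := QB q qs; have /andP[Q0' Qy'] := QB q' q's.
  suff : Q q = Q q' by rewrite /Q -rr => /(repunit_inj r1).
  apply: eqn_from_log => // p; have [pS|pS] := boolP (p \in S).
    have pi : index p S < k by apply: leq_trans Sk; rewrite index_mem.
    have := FE (Ordinal pi); rewrite !ffunE /= nth_index// => /(congr1 val)/=.
    by rewrite !inordK ?prednK ?logn_lt_exp2 ?QB.
  have l0 u : u \in s -> logn p (Q u) = 0.
    by move=> us'; apply/eqP; rewrite -leqn0 leqNgt logn_gt0; apply: contra pS; exact: QS.
  by rewrite !l0.
have um : uniq (map F s) by rewrite map_inj_in_uniq.
rewrite -(size_map F) -(card_uniqP um) (leq_trans (max_card _))//.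
by rewrite card_prod card_ffun !card_ord !prednK.
Qed.

Lemma block_size (k i : nat) (s : seq nat) (r : nat -> nat) (S : seq nat) :
  1 < i -> uniq s -> (forall q, q \in s -> prime q && (2 ^ i <= q < 2 ^ i.+1)) ->
  (forall q, q \in s -> prime (r q)) ->
  size S <= k -> (forall q p, q \in s -> p \in primes (repunit (r q) q) -> p \in S) ->
  size s <= exp_threshold k i * (i.+1 * exp_threshold k i) ^ k + k * (2 * i.+1 ^ k).
Proof.
move=> i1 us sP rp Sk QS; set B := exp_threshold k i.
rewrite -(count_predC (fun q => r q < B) s) -!size_filter; apply: leq_add.
  apply: (@block_small_size k i B _ r S); rewrite ?filter_uniq//.
  - by move=> q; rewrite mem_filter => /andP[_ /sP/andP[-> /andP[_ ->]]].
  - by move=> q; rewrite mem_filter => /andP[-> /rp/prime_gt1 ->].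
  - by move=> q p; rewrite mem_filter => /andP[_ qs]; exact: QS.
set t := seq.filter _ _.
have tP q : q \in t -> B <= r q /\ q \in s by rewrite mem_filter /= -leqNgt => /andP.
apply: (@leq_trans (\sum_(p <- S) 2 * i.+1 ^ k)); last first.
  by rewrite big_const_seq iter_addn_0 count_predT mulnC leq_mul2r Sk orbT.
(* Each q is counted at least once, through the least prime factor of its repunit, which lies in
   S. *)
apply: (@leq_trans (\sum_(p <- S) count (fun q => prime p && (p %| repunit (r q) q)) t)).
  rewrite -sum1_size; under [leqRHS]eq_bigr do rewrite -sum1_count big_mkcond.
  rewrite exchange_big/= big_seq [leqRHS]big_seq; apply: leq_sum => q qt.
  have [_ qs] := tP q qt; have /andP[pq /andP[q2 qy]] := sP q qs; have rq := rp q qs.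
  have Q1 : 1 < repunit (r q) q.
    have := @repunit_inj (r q) (prime_gt1 rq) 0 q.
    have := prime_gt1 pq; have := prime_gt1 rq.
    case: (r q) => [|[|r']]// _ q1 _; rewrite /repunit !big_ord_recl /= expn0 expn1 /bump/=; lia.
  have pQ : pdiv (repunit (r q) q) \in S.
    by apply: (QS q) => //; rewrite mem_primes pdiv_prime// pdiv_dvd ltnW.
  by rewrite (big_rem _ pQ)/= pdiv_prime// pdiv_dvd leq_addr.
rewrite big_seq [leqRHS]big_seq; apply: leq_sum => p pS.
rewrite -size_filter; have [pp|np] := boolP (prime p); last first.
  by rewrite (@eq_filter _ _ pred0) ?filter_pred0.
apply: (@block_class_size k i i1 p _ r S); rewrite ?filter_uniq//=.
- by move=> q; rewrite mem_filter => /andP[_ /tP[_ /sP]].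
- by move=> q; rewrite mem_filter => /andP[-> /tP[_ /rp ->]].
- by move=> q; rewrite mem_filter => /andP[_ /tP[]].
- by move=> q p'; rewrite mem_filter => /andP[_ /tP[_ qs]]; exact: QS.
Qed.

(* With c as below and V = 2^(2c) (i+1), the bound of [block_size] times i(i+1)
   is at most V^m. *)
Definition block_start (k : nat) : nat :=
  let c := 58 * k.+1 ^ 2 in let m := k.+1 * (c + 3) in 8 * m * (m + c).

Lemma block_start_bound k i : block_start k <= i ->
  (exp_threshold k i * (i.+1 * exp_threshold k i) ^ k + k * (2 * i.+1 ^ k))
    * (i * i.+1) <= 2 ^ i.
Proof.
rewrite /block_start /exp_threshold; set c := 58 * k.+1 ^ 2; set m := k.+1 * (c + 3).
move=> iB.
have c0 : 0 < c by rewrite muln_gt0 expn_gt0.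
have m0 : 0 < m by rewrite muln_gt0 addn_gt0 c0.
set y := i.+1; set V := 2 ^ (2 * c) * y.
have V1 : 1 < V.
  apply: (@leq_trans (2 ^ 1 * 1)) => //; rewrite leq_mul// leq_exp2l//; lia.
have V0 : 0 < V by exact: ltnW.
have yV : y <= V by rewrite leq_pmull// expn_gt0.
have kV : 2 * k <= V.
  apply: (@leq_trans (2 ^ (2 * c))); last by rewrite leq_pmulr.
  apply: (@leq_trans (2 * c)); last exact/ltnW/ltn_expl.
  rewrite leq_mul2l /c; nia.
set total := _ + _.
have totalB : total * (i * y) <= V ^ m.
  have e1 : V ^ c * (y * V ^ c) ^ k <= V ^ (c * k.+1 + k).
    have -> : c * k.+1 + k = c + c.+1 * k by lia.
    by rewrite expnD leq_mul// expnM leq_expn2r// expnS leq_mul2r yV orbT.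
  have e2 : k * (2 * y ^ k) <= V ^ (c * k.+1 + k).
    apply: (@leq_trans (V ^ (1 + k))).
      by rewrite expnD expn1 mulnA leq_mul ?leq_expn2r// mulnC.
    by rewrite leq_pexp2l// leq_add2r muln_gt0 c0.
  have e3 : i * y <= V ^ 2 by rewrite -mulnn leq_mul// (leq_trans (leqnSn i)).
  apply: (@leq_trans ((V ^ 1 * V ^ (c * k.+1 + k)) * V ^ 2)).
    apply: leq_mul => //; rewrite expn1; apply: (leq_trans (leq_add e1 e2)).
    by rewrite addnn -mul2n leq_mul2r V1 orbT.
  by rewrite -!expnD leq_pexp2l// /m; lia.
apply: (leq_trans totalB).
(* It suffices that y <= 2^s and m (2c + s) <= i. Half of i covers m s and the other half 2 c m,
   while y <= 2m (s + 1) <= s^2 <= 2^s because s >= 4 (m + c). *)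
pose s := i %/ (2 * m).
have s_ge : 4 * (m + c) <= s by rewrite leq_divRL ?muln_gt0//; lia.
have yB : y <= 2 ^ s.
  have i_lt : i < s.+1 * (2 * m) by rewrite ltn_ceil ?muln_gt0.
  have sq : s * s <= 2 ^ s.
    have : 4 <= s by apply: leq_trans s_ge; move: m0; move: (m) (c); clear; lia.
    elim: (s) => // s' IH; rewrite leq_eqVlt => /predU1P[<-//|].
    rewrite ltnS => s4; have := IH s4; rewrite expnS.
    by move: s4 (2 ^ s'); clear; nia.
  apply: leq_trans sq; apply: (leq_trans i_lt).
  by move: s_ge m0; move: (s) (m) (c); clear; nia.
have sm : s * (2 * m) <= i by exact: leq_trunc_div.
apply: (@leq_trans ((2 ^ (2 * c) * 2 ^ s) ^ m)).
  by rewrite leq_expn2r// leq_mul2l yB orbT.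
rewrite -expnD -expnM leq_exp2l//.
by move: iB sm; move: (m) (c) (s); clear; nia.
Qed.

(** * Computability of the bound *)

(** Arguments are read with [nth 0], which computes on tuples built by cons, so that most equations
    demanded by [rec_prim] hold by computation. *)
Lemma recursive_nth n i : i < n -> recursive (fun x : n.-tuple nat => nth 0 x i).
Proof.
by move=> ni; apply: (@rec_proj n (Ordinal ni)) => x; rewrite (tnth_nth 0).
Qed.

Lemma recursive_comp1 n (h : nat -> nat) (f : n.-tuple nat -> nat) :
  recursive (fun x : 1.-tuple nat => h (nth 0 x 0)) -> recursive f ->
  recursive (fun x => h (f x)).
Proof.
move=> hR fR; apply: (@rec_comp n 1 _ (fun _ => f) _ hR) => // x.
by rewrite (nth_mktuple (fun _ => f x) 0 ord0).
Qed.

Lemma recursive_comp2 n (h : nat -> nat -> nat) (f g : n.-tuple nat -> nat) :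
  recursive (fun x : 2.-tuple nat => h (nth 0 x 0) (nth 0 x 1)) ->
  recursive f -> recursive g -> recursive (fun x => h (f x) (g x)).
Proof.
move=> hR fR gR.
pose fg (i : 'I_2) := if i == ord0 then f else g.
apply: (@rec_comp n 2 _ fg _ hR) => [i|x]; first by rewrite /fg; case: ifP.
have e (i : 'I_2) : nth 0 [tuple fg i x | i < 2] i = fg i x by rewrite nth_mktuple.
by rewrite (e (Ordinal (isT : 0 < 2))) (e (Ordinal (isT : 1 < 2))).
Qed.

Lemma recursive_S n (f : n.-tuple nat -> nat) : recursive f -> recursive (fun x => (f x).+1).
Proof.
by move=> fR; apply: (recursive_comp1 (h := S)) => //; apply: rec_succ => x; rewrite /thead (tnth_nth 0).
Qed.

Lemma recursive_const n c : recursive (fun _ : n.-tuple nat => c).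
Proof. by elim: c => [|c IHc]; [exact: rec_zero|exact: recursive_S]. Qed.

Lemma recursive_add n (f g : n.-tuple nat -> nat) :
  recursive f -> recursive g -> recursive (fun x => f x + g x).
Proof.
apply: recursive_comp2; apply: (@rec_prim 1 (fun x => nth 0 x 0) (fun x => (nth 0 x 1).+1)) => //.
- exact: recursive_nth.
- exact/recursive_S/recursive_nth.
Qed.

Lemma recursive_mul n (f g : n.-tuple nat -> nat) :
  recursive f -> recursive g -> recursive (fun x => f x * g x).
Proof.
apply: recursive_comp2.
apply: (@rec_prim 1 (fun _ => 0) (fun x => nth 0 x 2 + nth 0 x 1)) => //.
- exact: recursive_const.
- by apply: recursive_add; exact: recursive_nth.
Qed.

Lemma recursive_exp n (f g : n.-tuple nat -> nat) :
  recursive f -> recursive g -> recursive (fun x => g x ^ f x).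
Proof.
(* [rec_prim] recurses on the first argument, so the exponent is put first. *)
apply: (@recursive_comp2 _ (fun a b => b ^ a)).
apply: (@rec_prim 1 (fun _ => 1) (fun x => nth 0 x 2 * nth 0 x 1)) => //.
- exact: recursive_const.
- by apply: recursive_mul; exact: recursive_nth.
- by move=> y x; rewrite /= expnS.
Qed.

(** The factor k + 1 comes from sigma M / M and the power of 2 from sigma N / N, so the product
    bounds a b. *)
Definition ratio_bound (k : nat) : nat := k.+1 * 2 ^ (block_start k).+1.

Lemma computable_ratio_bound : computable (fun k => (ratio_bound k).+1).
Proof.
have K : recursive (fun x : 1.-tuple nat => (thead x).+1) by exact: rec_succ.
have C c : recursive (fun _ : 1.-tuple nat => c) by exact: recursive_const.
have c : recursive (fun x : 1.-tuple nat => 58 * (thead x).+1 ^ 2).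
  by apply: recursive_mul => //; exact: recursive_exp.
have m : recursive (fun x : 1.-tuple nat => (thead x).+1 * (58 * (thead x).+1 ^ 2 + 3)).
  by apply: recursive_mul => //; exact: recursive_add.
apply/recursive_S/recursive_mul => //; apply: recursive_exp => //; apply: recursive_S.
by apply: recursive_mul; [exact: recursive_mul|exact: recursive_add].
Qed.

(** * Bounds for the two ratios sigma M / M and sigma N / N *)

Lemma sigma_le_omega M k : 0 < M -> omega M <= k -> sigma M <= k.+1 * M.
Proof.
move=> M0 Mk; have := sigma_le_prod M0.
have pr p : p \in primes M -> 1 < p by rewrite mem_primes => /andP[/prime_gt1].
have P0 : 0 < \prod_(p <- primes M) p.-1.
  by rewrite big_seq prodn_cond_gt0// => p /pr; case: p => [|[]].
have := @prod_le_pred_prod (primes M) (primes_uniq M) _.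
have -> : all (fun x => 1 < x) (primes M) by apply/allP => p /pr.
move=> /(_ isT) h1 h2; rewrite -(leq_pmul2r P0); apply: (leq_trans h2).
rewrite (mulnC k.+1) -mulnA leq_mul2l; apply/orP; right; apply: (leq_trans h1).
by rewrite leq_mul2r ltnS Mk orbT.
Qed.

Lemma sigma_le_omega_sigma N k : 0 < k -> 0 < N -> omega (sigma N) <= k ->
  sigma N <= 2 ^ (block_start k).+1 * N.
Proof.
move=> k0 N0 Nk.
have I1 : 1 < block_start k by rewrite /block_start !mulnS; lia.
apply: sigma_bound => // i iI.
pose r q := pdiv (logn q N).+1.
pose s := [seq q <- primes N | trunc_log 2 q == i].
have sP q : q \in s -> [/\ prime q, q \in primes N & trunc_log 2 q = i].
  rewrite mem_filter => /andP[/eqP qi qN]; split => //.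
  by move: qN; rewrite mem_primes => /andP[].
have rp q : q \in s -> prime (r q).
  move=> /sP[_ qN _]; apply: pdiv_prime; rewrite ltnS logn_gt0//.
have bs : size s <= exp_threshold k i * (i.+1 * exp_threshold k i) ^ k + k * (2 * i.+1 ^ k).
  apply: (@block_size k i s r (primes (sigma N))) => //.
  - exact: leq_trans I1 iI.
  - by rewrite filter_uniq// primes_uniq.
  - move=> q /sP[qp _ <-]; rewrite qp /=; exact: (trunc_log_bounds _ (prime_gt0 qp)).
  - move=> q p qs; have [qp qN _] := sP q qs; rewrite !mem_primes => /and3P[-> _ pQ].
    rewrite sigma_gt0//= (dvdn_trans pQ)//.
    (* A geometric sum of length r t has the one of length r as a factor, so passing from v_q(N) + 1
       to its prime factor r keeps a divisor of sigma N. *)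
    have [t tE] : exists t, (logn q N).+1 = r q * t.
      by have /dvdnP[t tE] := pdiv_dvd (logn q N).+1; exists t; rewrite mulnC.
    by apply: dvdn_trans (repunit_dvd_sigma N0 qp); rewrite tE repunitM dvdn_mulr.
rewrite -size_filter; apply: leq_trans (block_start_bound iI).
by rewrite leq_mul2r bs orbT.
Qed.

Theorem theorem1p1 :
  exists C0 : nat -> nat,
    computable C0 /\
    forall k : nat, 0 < k ->
      0 < C0 k /\
      forall N M a b : nat,
        0 < N -> 0 < M -> 0 < a -> 0 < b ->
        sigma N = a * M ->
        sigma M = b * N ->
        omega (sigma N) <= k ->
        a < C0 k /\ b < C0 k.
Proof.
exists (fun k => (ratio_bound k).+1); split; first exact: computable_ratio_bound.
move=> k k0; split => // N M a b N0 M0 a0 b0 NE ME Nk.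
have Mk : omega M <= k.
  apply: leq_trans Nk; apply: uniq_leq_size; first exact: primes_uniq.
  move=> p; rewrite !mem_primes => /and3P[-> _ pM].
  by rewrite sigma_gt0//= NE dvdn_mull.
have h1 := sigma_le_omega_sigma k0 N0 Nk; have h2 := sigma_le_omega M0 Mk.
have ab : a * b <= ratio_bound k.
  rewrite -(@leq_pmul2r (N * M)) ?muln_gt0 ?N0//.
  have -> : a * b * (N * M) = sigma N * sigma M by rewrite NE ME; lia.
  by apply: (leq_trans (leq_mul h1 h2)); rewrite /ratio_bound; lia.
by rewrite !ltnS; split; apply: leq_trans ab; [rewrite leq_pmulr|rewrite leq_pmull].
Qed.
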